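(* Let $R$ be a ring with a classical ring of quotients $Q$. Assume that $\mathrm{f.dim}\,Q=0$. Then the following hold. (i) The class $\mathcal{D}$ of divisible right $R$-modules is a $1$-tilting class and it coincides with $\mathcal{P}_1(\mathrm{mod}\text{-}R)^{\perp}$. (ii) The class $\mathcal{TF}$ of torsion free left $R$-modules coincides with $\mathcal{P}_1(\mathrm{mod}\text{-}R)^{\intercal}$.
   Context: Rings are associative with unit. ''Classical ring of quotients'' means the two-sided (Ore) classical ring of quotients: with $\Sigma$ the set of non zero divisors of $R$, $\Sigma$ satisfies the left and right Ore conditions and $Q=\Sigma^{-1}R=R\Sigma^{-1}$. $\mathrm{mod}\text{-}R$ is the class of right $R$-modules having a projective resolution consisting of finitely generated projective modules; $\mathcal{P}_1$ is the class of right $R$-modules of projective dimension at most $1$; $\mathcal{P}_1(\mathrm{mod}\text{-}R)=\mathcal{P}_1\cap\mathrm{mod}\text{-}R$. $\mathrm{f.dim}\,Q$ (right small finitistic dimension) is the supremum of the projective dimensions of the modules in $\mathrm{mod}\text{-}Q$ of finite projective dimension. A right $R$-module $D$ is divisible if $\mathrm{Ext}_R^1(R/rR,D)=0$ for every $r\in\Sigma$; a left $R$-module $Y$ is torsion free if $\mathrm{Tor}_1^R(R/rR,Y)=0$ for every $r\in\Sigma$. For a class $\mathcal{C}$ of right $R$-modules, $\mathcal{C}^{\perp}=\{X\in\mathrm{Mod}\text{-}R : \mathrm{Ext}_R^i(C,X)=0 \text{ for all } C\in\mathcal{C},\ i\ge 1\}$ and $\mathcal{C}^{\intercal}=\{X\in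 R\text{-}\mathrm{Mod} : \mathrm{Tor}^R_i(C,X)=0 \text{ for all } C\in\mathcal{C},\ i\ge 1\}$. A right $R$-module $T$ is $1$-tilting if it has projective dimension at most $1$, $\mathrm{Ext}^1_R(T,T^{(I)})=0$ for every set $I$, and there is an exact sequence $0\to R\to T_0\to T_1\to0$ with $T_0,T_1$ direct summands of direct sums of copies of $T$; a $1$-tilting class is a class of the form $T^{\perp}$ with $T$ $1$-tilting. *)

(* Defs.v *)
From HB Require Import structures.
From mathcomp Require Import all_boot all_algebra ring_quotient.
From mathcomp Require Import boolp classical_sets functions cardinality fsbigop.
From mathcomp Require Import freeg.

Set Implicit Arguments.
Unset Strict Implicit.
Unset Printing Implicit Defensive.

Import GRing.Theory.
Local Open Scope ring_scope.
Local Open Scope quotient_scope.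

(** Rings are [pzRingType]s (the zero ring is allowed).  The homological
    notions are defined for left modules over an arbitrary ring [A]; a right
    [R]-module is a left module over the opposite ring [R^c], so that
    [(r : R^c) *: m] is [m r]. *)
Notation rmodType R := (lmodType (R : pzRingType)^c).

Section DirectSum.
Variables (A : pzRingType) (I : Type) (M : lmodType A).

Definition finsupp : {pred I -> M} :=
  fun f => `[< finite_set [set i | f i != 0] >].

Lemma finsupp_submod : submod_closed finsupp.
Proof.
split=> [|a f g /asboolP finf /asboolP fing]; apply/asboolP.
  by apply: (@sub_finite_set _ _ set0) => // i /=; rewrite eqxx.
apply: (@sub_finite_set _ _ ([set i | f i != 0] `|` [set i | g i != 0])).
  move=> i /=; have [fi0|] := eqVneq (f i) 0; last by left.
  have [gi0|] := eqVneq (g i) 0; last by right.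
  by rewrite /= [X in X != 0](_ : _ = a *: f i + g i) // fi0 gi0 scaler0 addr0 eqxx.
by rewrite finite_setU.
Qed.

HB.instance Definition _ := GRing.isSubmodClosed.Build A (I -> M) finsupp
  (GRing.submod_closed_semi finsupp_submod).

(** [M^(I)] *)
Record dsum := Dsum { dsum_fun :> I -> M; _ : dsum_fun \in finsupp }.

HB.instance Definition _ := [isSub for dsum_fun].
HB.instance Definition _ := [Choice of dsum by <:].
HB.instance Definition _ := [SubChoice_isSubLmodule of dsum by <:].

End DirectSum.
Arguments dsum {A} I M.

Section ModuleQuotient.
Variables (A : pzRingType) (V : lmodType A) (N : submodClosed V).

Definition msub : {pred V} := fun x => x \in N.

Lemma msub_zmod : zmod_closed msub.
Proof. exact: GRing.submod_closedB (GRing.submodClosedP N). Qed.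
HB.instance Definition _ := GRing.isZmodClosed.Build V msub msub_zmod.

Definition mquot := Quotient.quot msub.
HB.instance Definition _ := GRing.Zmodule.on mquot.
HB.instance Definition _ := EqQuotient.on mquot.

Definition mquot_scale (a : A) := lift_op1 mquot ( *:%R a).

Lemma mquotE (x y : V) : (\pi_mquot x == \pi_mquot y) = (x - y \in N).
Proof. by rewrite -[RHS]/(x - y \in msub) Quotient.idealrBE. Qed.

Lemma mquot_scale_pi a (x : V) : mquot_scale a (\pi x) = \pi_mquot (a *: x).
Proof.
apply/eqP; unlock mquot_scale; rewrite mquotE -scalerBr.
by apply: rpredZ; rewrite -mquotE reprK eqxx.
Qed.

Lemma mquot_piD (x y : V) : \pi_mquot (x + y) = \pi_mquot x + \pi_mquot y.
Proof. exact: (@Quotient.pi_add V (msub : zmodClosed V) x y). Qed.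

Lemma mquot_scaleA a b q : mquot_scale a (mquot_scale b q) = mquot_scale (a * b) q.
Proof. by rewrite -[q]reprK !mquot_scale_pi scalerA. Qed.

Lemma mquot_scale1 : left_id 1 mquot_scale.
Proof. by move=> q; rewrite -[q]reprK mquot_scale_pi scale1r. Qed.

Lemma mquot_scaleDr : right_distributive mquot_scale +%R.
Proof.
move=> a p q; rewrite -[p]reprK -[q]reprK -mquot_piD !mquot_scale_pi.
by rewrite scalerDr mquot_piD.
Qed.

Lemma mquot_scaleDl q : {morph mquot_scale^~ q : a b / a + b}.
Proof.
by move=> a b; rewrite -[q]reprK !mquot_scale_pi scalerDl mquot_piD.
Qed.

HB.instance Definition _ := GRing.Zmodule_isLmodule.Build A mquot
  mquot_scaleA mquot_scale1 mquot_scaleDr mquot_scaleDl.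

Lemma mquot_pi_linear : linear (\pi_mquot : V -> mquot).
Proof. by move=> a x y; rewrite mquot_piD -mquot_scale_pi. Qed.

End ModuleQuotient.

Section CyclicModule.
Variables (R : pzRingType) (r : R).

Definition principal : {pred (R^c)^o} := fun x => `[< exists s : R, x = r * s :> R >].

Lemma principal_submod : submod_closed principal.
Proof.
split=> [|a x y /asboolP[s ->] /asboolP[t ->]]; apply/asboolP.
  by exists 0; rewrite mulr0.
by exists (s * (a : R) + t); rewrite mulrDr mulrA.
Qed.

HB.instance Definition _ := GRing.isSubmodClosed.Build R^c (R^c)^o principal
  (GRing.submod_closed_semi principal_submod).

(** [R / rR] *)
Definition cyclic_module : rmodType R := mquot principal.

End CyclicModule.

Section Tensor.
Variables (A : pzRingType) (M : rmodType A) (Y : lmodType A).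

Local Notation gen m y := (<< ((m, y) : (M * Y)%type) >> : {freeg (M * Y)%type}).

(** The subgroup of the free abelian group on [M * Y] generated by the
    bilinearity and balancing relations. *)
Inductive tensor_rel : {freeg (M * Y)%type} -> Prop :=
| tensor_rel_addl m m' y : tensor_rel (gen (m + m') y - gen m y - gen m' y)
| tensor_rel_addr m y y' : tensor_rel (gen m (y + y') - gen m y - gen m y')
| tensor_rel_bal (r : A) m y :
    tensor_rel (gen ((r : A^c) *: m) y - gen m (r *: y))
| tensor_rel0 : tensor_rel 0
| tensor_relB u v : tensor_rel u -> tensor_rel v -> tensor_rel (u - v).

Definition tensor_relb : {pred {freeg (M * Y)%type}} :=
  fun u => `[< tensor_rel u >].

Lemma tensor_relb_zmod : zmod_closed tensor_relb.
Proof.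
split=> [|u v /asboolP ru /asboolP rv]; apply/asboolP.
  exact: tensor_rel0.
exact: tensor_relB.
Qed.

HB.instance Definition _ :=
  GRing.isZmodClosed.Build {freeg (M * Y)%type} tensor_relb tensor_relb_zmod.

Definition tensor := Quotient.quot tensor_relb.
HB.instance Definition _ := GRing.Zmodule.on tensor.
HB.instance Definition _ := EqQuotient.on tensor.

Definition pure (m : M) (y : Y) : tensor := \pi_tensor (gen m y).

Section Lift.
Variables (G : zmodType) (b : M -> Y -> G).

Definition balanced :=
  [/\ forall m m' y, b (m + m') y = b m y + b m' y,
      forall m y y', b m (y + y') = b m y + b m y' &
      forall (r : A) m y, b ((r : A^c) *: m) y = b m (r *: y)].

(** The homomorphism [M (x) Y -> G] induced by [b]; meaningful only when [b] is
    balanced, see [tensor_liftE] and [tensor_liftB]. *)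
Definition tensor_lift (u : tensor) : G :=
  fglift (fun p : M * Y => b p.1 p.2 : zmodule G) (repr u).

Hypothesis bal : balanced.

Lemma tensor_lift_pi u :
  tensor_lift (\pi_tensor u) = fglift (fun p : M * Y => b p.1 p.2 : zmodule G) u.
Proof.
have [bl br bb] := bal.
set h := fglift _.
have hB : {morph h : x y / x - y} by exact: lift_is_additive.
have h0 : h 0 = 0 by rewrite -[X in h X](subrr 0) hB subrr.
have hg m y : h (gen m y) = b m y by rewrite /h liftU scale1r.
suff rel0 v : tensor_rel v -> h v = 0.
  apply/eqP; rewrite -subr_eq0 -hB; apply/eqP/rel0/asboolP.
  by rewrite -[`[< _ >]]/(_ \in tensor_relb) Quotient.idealrBE reprK.
elim=> {v} [m m' y|m y y'|r m y||v w _ hv _ hw].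
- by rewrite !hB !hg bl -addrA -opprD subrr.
- by rewrite !hB !hg br -addrA -opprD subrr.
- by rewrite !hB !hg bb subrr.
- exact: h0.
- by rewrite hB hv hw subrr.
Qed.

Lemma tensor_liftE m y : tensor_lift (pure m y) = b m y.
Proof. by rewrite tensor_lift_pi liftU scale1r. Qed.

Lemma tensor_liftB : zmod_morphism tensor_lift.
Proof.
move=> u v; rewrite -[u]reprK -[v]reprK.
have -> : \pi_tensor (repr u) - \pi_tensor (repr v) = \pi_tensor (repr u - repr v).
  by rewrite !piE.
by rewrite !tensor_lift_pi [LHS]lift_is_additive.
Qed.

End Lift.

End Tensor.

(** [f (x) Y] *)
Definition tensor_map (A : pzRingType) (M M' : rmodType A) (Y : lmodType A)
    (f : {linear M -> M'}) : tensor M Y -> tensor M' Y :=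
  tensor_lift (fun m y => pure (f m) y).

Definition exact_at (U V W : zmodType) (f : U -> V) (g : V -> W) : Prop :=
  forall v, g v = 0 <-> exists u, f u = v.

Definition surj (U V : Type) (f : U -> V) : Prop := forall v, exists u, f u = v.

Section Homological.
Variable A : pzRingType.

Definition projective (P : lmodType A) : Prop :=
  forall (M N : lmodType A) (p : {linear M -> N}) (f : {linear P -> N}),
    surj p -> exists g : {linear P -> M}, forall x, p (g x) = f x.

Definition fin_generated (M : lmodType A) : Prop :=
  exists (n : nat) (e : 'I_n -> M),
    forall x, exists c : 'I_n -> A, x = \sum_i c i *: e i.

(** [... -> P_2 -> P_1 -> P_0 -> M -> 0], with [res_d n : P_(n+1) -> P_n]. *)
Record resolution (M : lmodType A) := Resolution {
  res_mod :> nat -> lmodType A;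
  res_d : forall n, {linear res_mod n.+1 -> res_mod n};
  res_aug : {linear res_mod 0%N -> M};
  res_proj : forall n, projective (res_mod n);
  res_aug_surj : surj res_aug;
  res_exact0 : exact_at (res_d 0%N) res_aug;
  res_exactS : forall n, exact_at (res_d n.+1) (res_d n)
}.

Definition pd_le (M : lmodType A) (n : nat) : Prop :=
  exists P : resolution M, forall k, (n < k)%N -> forall x : P k, x = 0.

Definition has_pd (M : lmodType A) (n : nat) : Prop :=
  pd_le M n /\ forall m, pd_le M m -> (n <= m)%N.

(** The class [mod-A]. *)
Definition fp_infty (M : lmodType A) : Prop :=
  exists P : resolution M, forall n, fin_generated (P n).

(** The supremum is taken in [nat], where the zero module has projective
    dimension 0. *)
Definition has_fdim (d : nat) : Prop :=
  let bound e := forall (M : lmodType A) n,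
    fp_infty M -> has_pd M n -> (n <= e)%N in
  bound d /\ forall e, bound e -> (d <= e)%N.

(** Every module has a (free) resolution, so that quantifying over resolutions
    in [Ext0] and [Tor0] below is never vacuous. *)

Section Free.
Variable I : choiceType.

Definition delta_fun (i : I) : I -> A^o := fun j => (j == i)%:R.

Lemma delta_finsupp i : delta_fun i \in @finsupp A I A^o.
Proof.
apply/asboolP; apply: (@sub_finite_set _ _ [set i]) => [j /=|]; last first.
  exact: finite_set1.
by rewrite /delta_fun; have [//|_] := eqVneq j i; rewrite eqxx.
Qed.

Definition delta (i : I) : dsum I A^o := Dsum (delta_finsupp i).

Variables (M : lmodType A) (h : I -> M).

Definition dlift (f : dsum I A^o) : M :=
  \sum_(i \in [set i | f i != 0]%classic) (f i : A) *: h i.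

Lemma dsum_finite (f : dsum I A^o) : finite_set [set i | f i != 0].
Proof. by case: f => f /= /asboolP. Qed.

Lemma dliftE (f : dsum I A^o) (D : set I) :
    finite_set D -> (forall i, f i != 0 -> D i) ->
  dlift f = \sum_(i \in D) (f i : A) *: h i.
Proof.
move=> finD sub; apply: fsbig_widen => // i [_ /= /negP].
by rewrite negbK => /eqP ->; rewrite scale0r.
Qed.

Lemma dlift_linear : linear dlift.
Proof.
move=> a f g.
have fg i : (a *: f + g : dsum I A^o) i = a *: (f i : A^o) + g i by [].
set D := ([set i | f i != 0] `|` [set i | g i != 0])%classic.
have finD : finite_set D by rewrite finite_setU; split; exact: dsum_finite.
rewrite (@dliftE f D) // => [|i]; last by left.
rewrite (@dliftE g D) // => [|i]; last by right.
rewrite (@dliftE _ D) // => [|i]; last first.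
  rewrite [X in X != 0](fg i) => fgi; apply: contrapT => /not_orP[/negP + /negP].
  rewrite !negbK => /eqP fi /eqP gi.
  by move: fgi; rewrite fi gi scaler0 addr0 eqxx.
rewrite !fsbig_finite //= scaler_sumr -big_split /=; apply: eq_bigr => i _.
by rewrite [X in X *: _](fg i) scalerDl scalerA.
Qed.

HB.instance Definition _ :=
  GRing.isLinear.Build A (dsum I A^o) M *:%R dlift dlift_linear.

Lemma dlift_delta i : dlift (delta i) = h i.
Proof.
rewrite (@dliftE _ [set i]%classic) => [|//|j]; last first.
  by rewrite /= /delta_fun; have [//|_] := eqVneq j i; rewrite eqxx.
by rewrite fsbig_set1 /= /delta_fun eqxx scale1r.
Qed.

End Free.

Lemma dsum_delta (I : choiceType) (M : lmodType A) (g : {linear dsum I A^o -> M}) :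
  forall f, g f = dlift (fun i => g (delta i)) f.
Proof.
move=> f; rewrite /dlift fsbig_finite /=; last exact: dsum_finite.
under eq_bigr do rewrite -linearZ.
rewrite -linear_sum; congr (g _).
pose ev j (u : dsum I A^o) : A^o := u j.
have evD j : {morph ev j : u v / u + v} by [].
apply: val_inj; apply: funext => j /=.
rewrite -[RHS]/(ev j _) (big_morph (ev j) (evD j) (_ : _ = 0)) //.
have evZ i : ev j ((f i : A) *: delta i) = (f i : A) * (j == i)%:R by [].
under eq_bigr do rewrite evZ.
have [fj0|fj0] := eqVneq (f j) 0.
  rewrite fj0 big1 // => i _; have [<-|] := eqVneq j i.
    by rewrite fj0 mul0r.
  by rewrite mulr0.
rewrite (bigD1_seq j) /=; last 2 first.
- by rewrite in_fset_set ?inE //; exact: dsum_finite.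
- exact: finmap.fset_uniq.
by rewrite eqxx mulr1 big1 ?addr0 // => i /negbTE; rewrite eq_sym => ->; rewrite mulr0.
Qed.

Lemma free_projective (I : choiceType) : projective (dsum I A^o).
Proof.
move=> M N p f psurj.
have [c cP] := choice (fun i => psurj (f (delta i))).
exists (dlift c : {linear _ -> _}) => x /=.
pose pc : {linear dsum I A^o -> N} := p \o (dlift c : {linear _ -> _}).
rewrite -[LHS]/(pc x) (dsum_delta pc) [RHS]dsum_delta.
by congr (dlift _ x); apply: funext => i /=; rewrite dlift_delta cP.
Qed.

Section Kernel.
Variables (U V : lmodType A) (f : {linear U -> V}).

Definition ker_pred : {pred U} := fun x => f x == 0.

Lemma ker_submod : submod_closed ker_pred.
Proof.
split=> [|a x y /eqP fx /eqP fy]; apply/eqP; first exact: linear0.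
by rewrite linearP fx fy scaler0 addr0.
Qed.

HB.instance Definition _ := GRing.isSubmodClosed.Build A U ker_pred
  (GRing.submod_closed_semi ker_submod).

Record kermod := Kermod { ker_val :> U; _ : ker_val \in ker_pred }.

HB.instance Definition _ := [isSub for ker_val].
HB.instance Definition _ := [Choice of kermod by <:].
HB.instance Definition _ := [SubChoice_isSubLmodule of kermod by <:].

Lemma ker_val_linear : linear ker_val.
Proof. by []. Qed.
HB.instance Definition _ :=
  GRing.isLinear.Build A kermod U *:%R ker_val ker_val_linear.

Lemma ker_valP x : f x = 0 <-> exists k : kermod, ker_val k = x.
Proof.
split=> [fx|[[y /eqP fy] <-] //].
by exists (Kermod (introT eqP fx : x \in ker_pred)).
Qed.

End Kernel.

Definition free_cover (M : lmodType A) : {linear dsum M A^o -> M} := dlift id.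

Lemma free_cover_surj M : surj (free_cover M).
Proof. by move=> x; exists (delta x); exact: dlift_delta. Qed.

Fixpoint syzygy (M : lmodType A) (n : nat) : lmodType A :=
  if n is m.+1 then kermod (free_cover (syzygy M m)) else M.

Definition free_d M n : {linear dsum (syzygy M n.+1) A^o -> dsum (syzygy M n) A^o} :=
  (@ker_val _ _ (free_cover (syzygy M n)) : {linear _ -> _})
    \o free_cover (syzygy M n.+1).

Lemma resolution_exists (M : lmodType A) : inhabited (resolution M).
Proof.
have ex n : exact_at (free_d M n) (free_cover (syzygy M n)).
  move=> v; split=> [/ker_valP[k <-]|[u <-]].
    by have [u <-] := free_cover_surj k; exists u.
  by apply/ker_valP; exists (free_cover (syzygy M n.+1) u).
constructor; apply: (@Resolution M (fun n => dsum (syzygy M n) A^o)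
  (free_d M) (free_cover M)) => [n|||n].
- exact: free_projective.
- exact: free_cover_surj.
- exact: (ex 0%N).
move=> v; split=> [dv|/ex cv]; last first.
  by rewrite /free_d /= cv linear0.
by apply/ex; apply: val_inj; rewrite [LHS]dv.
Qed.

(** [H^i (Hom (P, X)) = 0] *)
Definition hom_coh0 (C : lmodType A) (P : resolution C) (i : nat)
    (X : lmodType A) : Prop :=
  match i with
  | 0 => forall f : {linear P 0%N -> X},
      (forall x, f (res_d P 0 x) = 0) -> forall x, f x = 0
  | j.+1 => forall f : {linear P j.+1 -> X},
      (forall x, f (res_d P j.+1 x) = 0) ->
      exists g : {linear P j -> X}, forall x, f x = g (res_d P j x)
  end.

(** [Ext_A^i (C, X) = 0]; that resolutions exist is [resolution_exists]. *)
Definition Ext0 (i : nat) (C X : lmodType A) : Prop :=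
  forall P : resolution C, hom_coh0 P i X.

Definition module_class := lmodType A -> Prop.

Definition Ext_perp (CC : module_class) : module_class :=
  fun X => forall C, CC C -> forall i, (1 <= i)%N -> Ext0 i C X.

Definition P1 : module_class := fun M => pd_le M 1.
Definition P1_mod : module_class := fun M => P1 M /\ fp_infty M.

Definition summand (M N : lmodType A) : Prop :=
  exists (s : {linear M -> N}) (p : {linear N -> M}), forall x, p (s x) = x.

Definition in_Add (T M : lmodType A) : Prop :=
  exists I : Type, summand M (dsum I T).

Definition one_tilting (T : lmodType A) : Prop :=
  [/\ pd_le T 1,
      forall I : Type, Ext0 1 T (dsum I T) &
      exists (T0 T1 : lmodType A) (f : {linear A^o -> T0}) (g : {linear T0 -> T1}),
        [/\ in_Add T T0, in_Add T T1, injective f, exact_at f g & surj g]].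

Definition one_tilting_class (CC : module_class) : Prop :=
  exists T, one_tilting T /\ forall X, CC X <-> Ext_perp (eq T) X.

End Homological.

Section TorDefinition.
Variable A : pzRingType.

(** [H_i (P (x) Y) = 0] *)
Definition tensor_hom0 (C : rmodType A) (P : resolution C) (i : nat)
    (Y : lmodType A) : Prop :=
  match i with
  | 0 => surj (@tensor_map A _ _ Y (res_d P 0))
  | j.+1 => exact_at (@tensor_map A _ _ Y (res_d P j.+1))
                     (@tensor_map A _ _ Y (res_d P j))
  end.

(** [Tor^A_i (C, Y) = 0] *)
Definition Tor0 (i : nat) (C : rmodType A) (Y : lmodType A) : Prop :=
  forall P : resolution C, tensor_hom0 P i Y.

Definition Tor_perp (CC : module_class A^c) : module_class A :=
  fun Y => forall C, CC C -> forall i, (1 <= i)%N -> Tor0 i C Y.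

End TorDefinition.

Section Quotients.
Variable R : pzRingType.

Definition regular_elt (s : R) : Prop := GRing.lreg s /\ GRing.rreg s.

Definition right_Ore : Prop := forall a s : R, regular_elt s ->
  exists b t : R, regular_elt t /\ a * t = s * b.

Definition left_Ore : Prop := forall a s : R, regular_elt s ->
  exists b t : R, regular_elt t /\ t * a = b * s.

Definition invertible (S : pzRingType) (x : S) : Prop :=
  exists y, y * x = 1 /\ x * y = 1.

(** The last two conditions say that every element of [Q] has the form
    [s^-1 a], and also the form [a s^-1]. *)
Definition classical_ring_of_quotients (Q : pzRingType)
    (iota : {rmorphism R -> Q}) : Prop :=
  [/\ right_Ore /\ left_Ore,
      injective iota,
      forall s, regular_elt s -> invertible (iota s),
      forall q, exists a s, regular_elt s /\ iota s * q = iota a &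
      forall q, exists a s, regular_elt s /\ q * iota s = iota a].

Definition divisible (D : rmodType R) : Prop :=
  forall r, regular_elt r -> Ext0 1 (cyclic_module r) D.

Definition torsion_free (Y : lmodType R) : Prop :=
  forall r, regular_elt r -> Tor0 1 (cyclic_module r) Y.

End Quotients.

(* Main.v *)
From HB Require Import structures.
From mathcomp Require Import all_boot all_algebra ring_quotient.
From mathcomp Require Import boolp classical_sets cardinality fsbigop.
From mathcomp Require Import freeg.
Require Import Defs.

Set Implicit Arguments.
Unset Strict Implicit.
Unset Printing Implicit Defensive.

Import GRing.Theory.
Local Open Scope ring_scope.
Local Open Scope quotient_scope.

(** Write [A := R^c], so that all modules below are left modules, and let [M] be
    in [P_1(mod-R)], with presentation [0 -> K -> A^n -> M -> 0], [K] finitely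
    generated projective and embedded as a summand [e : K -> A^m].  Over [Q] the
    map [K -> A^n] stays injective, by clearing denominators, and its cokernel
    has projective dimension at most 1; since f.dim [Q] = 0 it is projective and
    the map splits.  A common denominator [s] of the splitting gives a map
    [a : A^n -> A^m] over [A] whose restriction to [K] is [e] followed by
    multiplication by [s].  If [s] acts surjectively on [D], every map
    [K -> D] therefore extends to [A^n]; if [s] acts injectively on [Y],
    [K (x) Y -> A^n (x) Y] is injective.

    The tilting module is Fuchs' divisible module: [T_0] has generators [e_w]
    indexed by the finite sequences [w], and relations [s e_(s::w) = e_w] for [s]
    regular; [T_1] is the quotient of [T_0] by [A e_nil] and [T = T_0 (+) T_1].
    The relations are linearly independent, so that [T] has projective dimension
    at most 1, and maps out of [T] are controlled by recursion on [w]. *)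

(** * Linear algebra over a ring *)

Section LinearMaps.
Variable A : pzRingType.
Implicit Types U V W M N P X : lmodType A.

Definition short_exact U V W (f : U -> V) (g : V -> W) : Prop :=
  [/\ injective f, exact_at f g & surj g].

Lemma linear_inj U V (f : {linear U -> V}) :
  (forall x, f x = 0 -> x = 0) -> injective f.
Proof. by move=> f0 x y fxy; apply/subr0_eq/f0; rewrite linearB fxy subrr. Qed.

(** Uniqueness makes the chosen function linear: [a *: g x + g x'] is an admissible value at
    [a *: x + x'], hence the only one. *)
Lemma linear_choice U V (r : U -> V -> Prop) :
    (forall x, exists y, r x y) -> (forall x y z, r x y -> r x z -> y = z) ->
    (forall a x x' y y', r x y -> r x' y' -> r (a *: x + x') (a *: y + y')) ->
  exists g : {linear U -> V}, forall x, r x (g x).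
Proof.
move=> /choice[g gP] uniq lin.
have g_lin : linear g by move=> a x y; apply: (uniq _ _ _ (gP _)); exact: lin.
pose gI := GRing.isLinear.Build A U V *:%R g g_lin.
pose gL : {linear U -> V} := HB.pack g gI.
by exists gL.
Qed.

Lemma lift_inj U V W (f : {linear U -> V}) (g : {linear W -> V}) :
    injective f -> (forall x, exists y, f y = g x) ->
  exists h : {linear W -> U}, forall x, f (h x) = g x.
Proof.
move=> finj fg; apply: (@linear_choice W U (fun x y => f y = g x)) => //.
- by move=> x y z fy fz; apply: finj; rewrite fy fz.
- by move=> a x x' y y' fy fy'; rewrite !linearP fy fy'.
Qed.

(** Both [f] and [h] factor through the kernel of [g], and exactness makes [f] surjective onto
    it. *)
Lemma lift_exact P U V W (f : {linear U -> V}) (g : {linear V -> W})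
    (h : {linear P -> V}) :
    projective P -> exact_at f g -> (forall x, g (h x) = 0) ->
  exists k : {linear P -> U}, forall x, f (k x) = h x.
Proof.
move=> Pproj fg gh.
have ker_inj : injective (@ker_val _ _ _ g) by exact: val_inj.
have [h' h'E] : exists h' : {linear P -> kermod g}, forall x, ker_val (h' x) = h x.
  by apply: lift_inj => // x; apply/ker_valP/gh.
have [f' f'E] : exists f' : {linear U -> kermod g}, forall x, ker_val (f' x) = f x.
  by apply: lift_inj => // x; apply/ker_valP/fg; exists x.
have [|k kE] := Pproj _ _ f' h'.
  move=> v; have /fg[u fu] : g (ker_val v) = 0 by apply/ker_valP; exists v.
  by exists u; apply: ker_inj; rewrite f'E.
by exists k => x; rewrite -f'E kE h'E.
Qed.

Lemma summand_projective M P : summand M P -> projective P -> projective M.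
Proof.
move=> [s [p ps]] Pproj U V q f /(Pproj _ _ q (f \o p : {linear _ -> _}))[g gE].
by exists (g \o s : {linear _ -> _}) => x /=; rewrite gE /= ps.
Qed.

Definition pair_inl M N (x : M) : (M * N)%type := (x, 0).
Definition pair_inr M N (y : N) : (M * N)%type := (0, y).

Lemma pair_inl_linear M N : linear (@pair_inl M N).
Proof. by move=> a x y; apply/eqP; rewrite xpair_eqE /= scaler0 addr0 !eqxx. Qed.
HB.instance Definition _ M N :=
  GRing.isLinear.Build A M (M * N)%type *:%R (@pair_inl M N) (@pair_inl_linear M N).

Lemma pair_inr_linear M N : linear (@pair_inr M N).
Proof. by move=> a x y; apply/eqP; rewrite xpair_eqE /= scaler0 addr0 !eqxx. Qed.
HB.instance Definition _ M N :=
  GRing.isLinear.Build A N (M * N)%type *:%R (@pair_inr M N) (@pair_inr_linear M N).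

Lemma pair_inlr M N (z : (M * N)%type) : pair_inl N z.1 + pair_inr M z.2 = z.
Proof. by case: z => x y; apply/eqP; rewrite xpair_eqE /= addr0 add0r !eqxx. Qed.

Definition copair M N X (f : {linear M -> X}) (g : {linear N -> X}) :
    {linear (M * N)%type -> X} :=
  (f \o (fst : {linear (M * N)%type -> M})) \+ (g \o (snd : {linear (M * N)%type -> N})).

Lemma projective_prod P P' : projective P -> projective P' -> projective (P * P')%type.
Proof.
move=> pP pP' U V q f qsurj.
have [g gE] := pP _ _ q (f \o @pair_inl P P' : {linear _ -> _}) qsurj.
have [h hE] := pP' _ _ q (f \o @pair_inr P P' : {linear _ -> _}) qsurj.
exists (copair g h) => z /=.
by rewrite linearD gE hE /= -linearD pair_inlr.
Qed.

Lemma summand_trans M N X : summand M N -> summand N X -> summand M X.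
Proof.
move=> [s [p ps]] [s' [p' ps']].
by exists (s' \o s : {linear _ -> _}), (p \o p' : {linear _ -> _}) => x; rewrite /= ps' ps.
Qed.

Lemma summand_prodl M N : summand M (M * N)%type.
Proof. by exists (@pair_inl M N), (fst : {linear (M * N)%type -> M}). Qed.

Lemma summand_prodr M N : summand N (M * N)%type.
Proof. by exists (@pair_inr M N), (snd : {linear (M * N)%type -> N}). Qed.

Definition prodmap M N M' N' (f : {linear M -> M'}) (g : {linear N -> N'}) :
    {linear (M * N)%type -> (M' * N')%type} :=
  copair (@pair_inl M' N' \o f) (@pair_inr M' N' \o g).

Lemma prodmapE M N M' N' (f : {linear M -> M'}) (g : {linear N -> N'}) z :
  prodmap f g z = (f z.1, g z.2).
Proof. exact: (pair_inlr (f z.1, g z.2)). Qed.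

Lemma short_exact_prod M N V M' N' V' (f : {linear M -> N}) (g : {linear N -> V})
    (f' : {linear M' -> N'}) (g' : {linear N' -> V'}) :
  short_exact f g -> short_exact f' g' -> short_exact (prodmap f f') (prodmap g g').
Proof.
move=> [fi fg gs] [fi' fg' gs']; split.
- move=> [x x'] [y y']; rewrite !prodmapE /= => E.
  by rewrite (fi _ _ (congr1 fst E)) (fi' _ _ (congr1 snd E)).
- move=> [y y']; rewrite prodmapE; split=> [E|[[x x']]].
    have [x fx] := (fg y).1 (congr1 fst E); have [x' fx'] := (fg' y').1 (congr1 snd E).
    by exists (x, x'); rewrite prodmapE fx fx'.
  rewrite prodmapE /= => -[<- <-].
  have -> : g (f x) = 0 by apply/fg; exists x.
  by have -> : g' (f' x') = 0 by apply/fg'; exists x'.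
- move=> [z z']; have [y <-] := gs z; have [y' <-] := gs' z'.
  by exists (y, y'); rewrite prodmapE.
Qed.

(** Surjectivity of Hom(N, X) -> Hom(M, X). When [f] is the injection of a two-term projective
    resolution, this expresses the vanishing of Ext^1. *)
Definition extends M N (f : {linear M -> N}) X := forall h : {linear M -> X},
  exists g : {linear N -> X}, forall x, h x = g (f x).

Lemma extends_prod M N M' N' (f : {linear M -> N}) (f' : {linear M' -> N'}) X :
  extends f X -> extends f' X -> extends (prodmap f f') X.
Proof.
move=> fX fX' h; have [g gE] := fX (h \o @pair_inl M M' : {linear _ -> _}).
have [g' gE'] := fX' (h \o @pair_inr M M' : {linear _ -> _}).
exists (copair g g') => z; rewrite prodmapE /= -gE -gE' /=.
by rewrite -linearD pair_inlr.
Qed.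

Lemma extends_prodr M N M' N' (f : {linear M -> N}) (f' : {linear M' -> N'}) X :
  extends (prodmap f f') X -> extends f' X.
Proof.
move=> fX h; have [g gE] := fX (h \o (snd : {linear (M * M')%type -> M'}) : {linear _ -> _}).
exists (g \o @pair_inr N N' : {linear _ -> _}) => x.
by have := gE (0, x); rewrite prodmapE /= linear0.
Qed.

Lemma fg_surj M N (f : {linear M -> N}) : surj f -> fin_generated M -> fin_generated N.
Proof.
move=> fsurj [n [e eE]]; exists n, (f \o e) => y.
have [x <-] := fsurj y; have [c ->] := eE x.
by exists c; rewrite linear_sum; apply: eq_bigr => i _; rewrite linearZ.
Qed.

Lemma fg_prod M N : fin_generated M -> fin_generated N -> fin_generated (M * N)%type.
Proof.
move=> [m [e eE]] [n [f fE]].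
exists (m + n)%N, (fun i =>
  match fintype.split i with inl i => (e i, 0) | inr i => (0, f i) end).
move=> [x y]; have [c xE] := eE x; have [d yE] := fE y.
exists (fun i => match fintype.split i with inl i => c i | inr i => d i end).
rewrite big_split_ord /=.
under eq_bigr => i _ do rewrite (unsplitK (inl _ i)).
under [X in _ + X]eq_bigr => i _ do rewrite (unsplitK (inr _ i)).
rewrite xE yE [RHS]surjective_pairing !raddfD /= !raddf_sum /=.
congr pair; [rewrite [X in _ + X]big1 ?addr0|rewrite [X in X + _]big1 ?add0r] => //.
- by move=> i _; rewrite scaler0.
- by move=> i _; rewrite scaler0.
Qed.

(** Row vectors serve as the free module A^n, so that linear maps between such modules can be
    handled as matrices. *)
Definition rowlift M n (e : 'I_n -> M) (x : 'rV[A]_n) : M := \sum_i x 0 i *: e i.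

Lemma rowlift_linear M n (e : 'I_n -> M) : linear (rowlift e).
Proof.
move=> a x y; rewrite /rowlift scaler_sumr -big_split; apply: eq_bigr => i _ /=.
by rewrite !mxE scalerDl scalerA.
Qed.
HB.instance Definition _ M n (e : 'I_n -> M) :=
  GRing.isLinear.Build A 'rV[A]_n M *:%R (rowlift e) (rowlift_linear e).

Lemma linear_rowlift M n (f : {linear 'rV[A]_n -> M}) x :
  f x = rowlift (fun i => f (delta_mx 0 i)) x.
Proof.
rewrite [in LHS](row_sum_delta x) linear_sum.
by apply: eq_bigr => i _; rewrite linearZ.
Qed.

Lemma rowlift_delta M n (e : 'I_n -> M) i : rowlift e (delta_mx 0 i) = e i.
Proof.
rewrite /rowlift (bigD1 i) //= mxE !eqxx scale1r big1 ?addr0 // => j ji.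
by rewrite mxE eqxx (negbTE ji) scale0r.
Qed.

Lemma row_projective n : projective 'rV[A]_n.
Proof.
move=> M N p f psurj; have [c cE] := choice (fun i => psurj (f (delta_mx 0 i))).
exists (rowlift c : {linear _ -> _}) => x.
rewrite [RHS]linear_rowlift /= /rowlift linear_sum.
by apply: eq_bigr => i _; rewrite linearZ cE.
Qed.

Lemma row_fg n : fin_generated 'rV[A]_n.
Proof. by exists n, (delta_mx 0) => x; exists (x 0); exact: row_sum_delta. Qed.

Lemma fg_rowP M : fin_generated M -> exists n (p : {linear 'rV[A]_n -> M}), surj p.
Proof.
move=> [n [e eE]]; exists n, (rowlift e : {linear _ -> _}) => x.
have [c ->] := eE x; exists (\row_i c i) => /=.
by apply: eq_bigr => i _; rewrite mxE.
Qed.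

End LinearMaps.

(** * Independence of the resolution *)

Section Comparison.
Variables (A : pzRingType) (C : lmodType A) (P P' : resolution C).

Lemma res_dd (Q : resolution C) n x : res_d Q n (res_d Q n.+1 x) = 0.
Proof. by apply/(@res_exactS _ _ Q); exists x. Qed.

Lemma res_augd (Q : resolution C) x : res_aug Q (res_d Q 0 x) = 0.
Proof. by apply/(@res_exact0 _ _ Q); exists x. Qed.

Lemma lift_chain (Q Q' : resolution C) n (u : {linear Q n -> Q' n})
    (u' : {linear Q n.+1 -> Q' n.+1}) :
    (forall x, res_d Q' n (u' x) = u (res_d Q n x)) ->
  exists u'' : {linear Q n.+2 -> Q' n.+2},
    forall x, res_d Q' n.+1 (u'' x) = u' (res_d Q n.+1 x).
Proof.
move=> comm; apply: (lift_exact (h := u' \o res_d Q n.+1 : {linear _ -> _})).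
- exact: res_proj.
- exact: res_exactS.
- by move=> x /=; rewrite comm res_dd linear0.
Qed.

(** The chain maps go both ways, but a homotopy is kept only for the composite on [P']; this is
    enough to carry vanishing from [P] to [P']. The induction remembers two consecutive degrees. *)
Lemma comparison n :
  exists (u : {linear P' n -> P n}) (u' : {linear P' n.+1 -> P n.+1})
    (v : {linear P n -> P' n}) (v' : {linear P n.+1 -> P' n.+1})
    (h : {linear P' n -> P' n.+1}) (h' : {linear P' n.+1 -> P' n.+2}),
  [/\ forall x, res_d P n (u' x) = u (res_d P' n x),
      forall x, res_d P' n (v' x) = v (res_d P n x) &
      forall x, v' (u' x) - x = res_d P' n.+1 (h' x) + h (res_d P' n x)].
Proof.
elim: n => [|n [u [u' [v [v' [h [h' [uE vE hE]]]]]]]]; last first.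
  have [u'' u''E] := lift_chain uE; have [v'' v''E] := lift_chain vE.
  (* The next homotopy lifts v'' u'' - 1 - h' d, which the differential kills by the homotopy
     identity one degree lower. *)
  have [||x|h'' h''E] := @lift_exact _ (P' n.+2) _ _ _ (res_d P' n.+2) (res_d P' n.+1)
    ((v'' \o u'') \- (idfun : {linear P' n.+2 -> P' n.+2})
      \- (h' \o res_d P' n.+1) : {linear _ -> _}).
  - exact: res_proj.
  - exact: res_exactS.
  - rewrite /= !linearB /= v''E u''E.
    by rewrite [X in X - _]hE res_dd linear0 addr0 subrr.
  exists u', u'', v', v'', h', h''; split=> // x.
  by rewrite h''E /= subrK.
have lift0 (Q Q' : resolution C) : exists u : {linear Q 0%N -> Q' 0%N},
    forall x, res_aug Q' (u x) = res_aug Q x.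
  by apply: (@res_proj _ _ Q 0%N); exact: res_aug_surj.
have lift1 (Q Q' : resolution C) (u : {linear Q 0%N -> Q' 0%N}) :
    (forall x, res_aug Q' (u x) = res_aug Q x) ->
    exists u' : {linear Q 1%N -> Q' 1%N}, forall x, res_d Q' 0 (u' x) = u (res_d Q 0 x).
  move=> uE; apply: (lift_exact (h := u \o res_d Q 0 : {linear _ -> _})).
  - exact: res_proj.
  - exact: res_exact0.
  - by move=> x /=; rewrite uE res_augd.
have [u uE] := lift0 P' P; have [v vE] := lift0 P P'.
have [u' u'E] := lift1 _ _ _ uE; have [v' v'E] := lift1 _ _ _ vE.
have [||x|h hE] := @lift_exact _ (P' 0%N) _ _ _ (res_d P' 0) (res_aug P')
  ((v \o u) \- (idfun : {linear P' 0%N -> P' 0%N}) : {linear _ -> _}).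
- exact: res_proj.
- exact: res_exact0.
- by rewrite linearB /= vE uE subrr.
have [||x|h' h'E] := @lift_exact _ (P' 1%N) _ _ _ (res_d P' 1) (res_d P' 0)
    ((v' \o u') \- (idfun : {linear P' 1%N -> P' 1%N})
      \- (h \o res_d P' 0) : {linear _ -> _}).
- exact: res_proj.
- exact: res_exactS.
- by rewrite /= !linearB /= v'E u'E hE /= subrr.
by exists u, u', v, v', h, h'; split=> // x; rewrite h'E /= subrK.
Qed.

(** A cocycle [f] on [P'] pulled back along v' becomes a coboundary g d on [P]; the homotopy then
    gives f = (g u - f h) d. *)
Lemma hom_coh0_indep i X : hom_coh0 P i.+1 X -> hom_coh0 P' i.+1 X.
Proof.
move=> PX f fd; have [u [u' [v [v' [h [h' [uE vE hE]]]]]]] := comparison i.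
have [v'' v''E] := lift_chain vE.
have [|g gE] := PX (f \o v' : {linear _ -> _}).
  by move=> x /=; rewrite -v''E fd.
exists ((g \o u) \- (f \o h) : {linear _ -> _}) => x /=.
by rewrite -uE -gE /= -[x in LHS](subKr (v' (u' x))) linearB hE linearD fd add0r.
Qed.

End Comparison.

(** * Ext through a two-term projective resolution *)

Section TwoTermResolution.
Variables (A : pzRingType) (M K P : lmodType A).
Variables (f : {linear K -> P}) (p : {linear P -> M}).
Hypotheses (Kproj : projective K) (Pproj : projective P) (fp : short_exact f p).

(** Rows of length 0 realise the zero module in the degrees above 1, already known to be projective
    and finitely generated. *)
Definition two_term_mod (n : nat) : lmodType A :=
  match n with 0 => P | 1 => K | _ => 'rV[A]_0 end.

Definition two_term_d (n : nat) : {linear two_term_mod n.+1 -> two_term_mod n} :=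
  match n with 0 => f | _ => \0 end.

Lemma two_term_proj n : projective (two_term_mod n).
Proof. by case: n => [|[|n]] //; exact: row_projective. Qed.

Lemma two_term_exact n : exact_at (two_term_d n.+1) (two_term_d n).
Proof.
have [finj _ _] := fp; case: n => [|n] v; last first.
  by split=> // _; exists 0; case: n v => [|n] v; rewrite [v]thinmx0 /= ?linear0 //.
split=> [fv|[u <-]]; last exact: linear0.
by exists 0; apply: finj; rewrite fv !linear0.
Qed.

Lemma short_exact_exact : exact_at f p. Proof. by case: fp. Qed.
Lemma short_exact_surj : surj p. Proof. by case: fp. Qed.

Definition two_term : resolution M :=
  Resolution two_term_proj short_exact_surj short_exact_exact two_term_exact.

Lemma pd_le_two_term : pd_le M 1.
Proof. by exists two_term => -[|[|k]] // _ x; exact: thinmx0. Qed.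

Lemma fp_infty_two_term : fin_generated K -> fin_generated P -> fp_infty M.
Proof. by move=> fgK fgP; exists two_term => -[|[|n]] //; exact: row_fg. Qed.

Lemma Ext0_extends X : Ext0 1 M X -> extends f X.
Proof.
by move=> /(_ two_term) /= MX h; have [x|g gE] := MX h; [exact: linear0|exists g].
Qed.

(** By independence of the resolution, it is enough to look at the two-term one, where only degree 1
    carries a condition. *)
Lemma extends_Ext0 X i : extends f X -> (1 <= i)%N -> Ext0 i M X.
Proof.
case: i => // i fX _ Q; apply: (@hom_coh0_indep _ _ two_term Q).
case: i => [|i] h hd; first by have [g] := fX h; exists g.
by exists \0 => x; rewrite [x]thinmx0 linear0.
Qed.

End TwoTermResolution.

(** * Functoriality of the tensor product and independence of Tor from the resolution *)

Section TensorMap.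
Variable A : pzRingType.
Implicit Types (M N : rmodType A) (Y : lmodType A) (G : zmodType).

Lemma tensor_pi_eq M Y (u v : {freeg (M * Y)%type}) :
  tensor_rel (u - v) -> \pi_(tensor M Y) u = \pi v.
Proof.
move=> uv; apply/eqP; rewrite -(Quotient.idealrBE (tensor_relb (Y:=Y))).
exact/asboolP.
Qed.

Lemma tensor_piB M Y (u v : {freeg (M * Y)%type}) :
  \pi_(tensor M Y) (u - v) = \pi u - \pi v.
Proof. by rewrite !piE. Qed.

(** Every tensor is an integer combination of pure ones, and closure under subtraction already
    yields 0, opposites, sums and multiples. *)
Lemma tensor_ind M Y (Z : tensor M Y -> Prop) :
    (forall u v, Z u -> Z v -> Z (u - v)) -> (forall m y, Z (pure m y)) ->
  forall u, Z u.
Proof.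
move=> ZB Zpure u.
have Z0 : Z 0 by rewrite -(subrr (pure 0 0)); apply: ZB.
have ZN v : Z v -> Z (- v) by rewrite -sub0r; exact: ZB.
have ZD v w : Z v -> Z w -> Z (v + w) by move=> Zv /ZN Zw; rewrite -[w]opprK; apply: ZB.
have ZMn v n : Z v -> Z (v *+ n).
  by move=> Zv; elim: n => [|n IH]; rewrite ?mulr0n // mulrS; apply: ZD.
pose pi : {additive {freeg (M * Y)%type} -> tensor M Y} :=
  HB.pack (fun v : {freeg (M * Y)%type} => \pi_(tensor M Y) v : tensor M Y)
    (GRing.isZmodMorphism.Build {freeg (M * Y)%type} (tensor M Y)
      (fun v => \pi_(tensor M Y) v) (@tensor_piB M Y)).
rewrite -[u]reprK -[\pi _]/(pi _).
elim/freeg_ind_dom0: (repr u) => [|k [m y] D _ _ ZpiD]; first by rewrite raddf0.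
rewrite raddfD; apply: ZD => //.
rewrite -[k]intz -freegU_mulz; case: (k : int) => n; rewrite /intmul ?raddfN raddfMn.
  exact/ZMn/Zpure.
exact/ZN/ZMn/Zpure.
Qed.

Lemma tensor_ext M Y G (f g : tensor M Y -> G) :
  zmod_morphism f -> zmod_morphism g -> (forall m y, f (pure m y) = g (pure m y)) -> f =1 g.
Proof. by move=> fB gB fg; elim/tensor_ind => // u v fu fv; rewrite fB gB fu fv. Qed.

Lemma pure_balanced M Y : balanced (@pure A M Y).
Proof.
have piD (u v : {freeg (M * Y)%type}) : \pi_(tensor M Y) u + \pi v = \pi_(tensor M Y) (u + v).
  by rewrite !piE.
split=> [m m' y|m y y'|r m y]; rewrite /pure ?piD; apply: tensor_pi_eq.
- by rewrite opprD addrA; exact: tensor_rel_addl.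
- by rewrite opprD addrA; exact: tensor_rel_addr.
- exact: tensor_rel_bal.
Qed.

Lemma pure0l M Y (y : Y) : pure (0 : M) y = 0.
Proof.
by have [D _ _] := pure_balanced M Y; apply: (addIr (pure 0 y)); rewrite -D !add0r.
Qed.

Lemma pure0r M Y (m : M) : pure m (0 : Y) = 0.
Proof.
by have [_ D _] := pure_balanced M Y; apply: (addIr (pure m 0)); rewrite -D !add0r.
Qed.

Lemma tensor_map_balanced M N Y (f : {linear M -> N}) :
  balanced (fun m (y : Y) => pure (f m) y).
Proof.
have [D D' Z] := pure_balanced N Y.
split=> [m m' y|m y y'|r m y]; rewrite ?linearD ?linearZ.
- exact: D.
- exact: D'.
- exact: Z.
Qed.

Lemma tensor_map_pure M N Y (f : {linear M -> N}) m (y : Y) :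
  tensor_map f (pure m y) = pure (f m) y.
Proof. exact: tensor_liftE (tensor_map_balanced Y f) m y. Qed.

Lemma tensor_mapB M N Y (f : {linear M -> N}) : zmod_morphism (@tensor_map A M N Y f).
Proof. exact: tensor_liftB (tensor_map_balanced Y f). Qed.

HB.instance Definition _ M N Y (f : {linear M -> N}) :=
  GRing.isZmodMorphism.Build (tensor M Y) (tensor N Y) (@tensor_map A M N Y f)
    (tensor_mapB f).

Lemma tensor_map_comp M N N' Y (g : {linear N -> N'}) (f : {linear M -> N})
    (h : {linear M -> N'}) :
    (forall x, g (f x) = h x) ->
  forall u : tensor M Y, tensor_map g (tensor_map f u) = tensor_map h u.
Proof.
move=> gf; apply: tensor_ext => [u v|u v|m y]; rewrite ?raddfB //.
by rewrite !tensor_map_pure gf.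
Qed.

Lemma tensor_map_id M Y (f : {linear M -> M}) : (forall x, f x = x) ->
  forall u : tensor M Y, tensor_map f u = u.
Proof.
by move=> f1; apply: tensor_ext => [u v|u v|m y] //; rewrite ?raddfB // tensor_map_pure f1.
Qed.

Lemma tensor_map0 M N Y (f : {linear M -> N}) : (forall x, f x = 0) ->
  forall u : tensor M Y, tensor_map f u = 0.
Proof.
move=> f0; apply: tensor_ext => [u v|u v|m y]; rewrite ?raddfB ?subr0 //.
by rewrite tensor_map_pure f0 pure0l.
Qed.

Lemma tensor_map_add M N Y (f g h : {linear M -> N}) : (forall x, h x = f x + g x) ->
  forall u : tensor M Y, tensor_map h u = tensor_map f u + tensor_map g u.
Proof.
have [D _ _] := pure_balanced N Y.
move=> fgh; apply: tensor_ext => [u v|u v|m y]; rewrite ?raddfB //.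
  by rewrite addrACA opprD.
by rewrite !tensor_map_pure fgh D.
Qed.

(** If [z] is a cycle and u' z = d y, the homotopy tensored with [Y] gives z = d (v'' y - h' z). *)
Lemma tensor_hom0_indep (C : rmodType A) (P P' : resolution C) i Y :
  tensor_hom0 P i.+1 Y -> tensor_hom0 P' i.+1 Y.
Proof.
have [u [u' [v [v' [h [h' [uE vE hE]]]]]]] := comparison P P' i.
have [v'' v''E] := lift_chain vE.
move=> PY z; split=> [dz|[w <-]]; last first.
  rewrite (tensor_map_comp (h := \0 : {linear _ -> _})); last exact: res_dd.
  exact: tensor_map0.
have /PY[y yE] : tensor_map (res_d P i) (tensor_map u' z) = 0.
  pose ud : {linear P' i.+1 -> P i} := u \o res_d P' i.
  rewrite (tensor_map_comp (h := ud) uE).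
  by rewrite -(tensor_map_comp (f := res_d P' i) (g := u)) // dz raddf0.
exists (tensor_map v'' y - tensor_map h' z); rewrite tensor_mapB.
pose v'd : {linear P i.+2 -> P' i.+1} := v' \o res_d P i.+1.
rewrite (tensor_map_comp (h := v'd) v''E).
rewrite -(tensor_map_comp (f := res_d P i.+1) (g := v')) // yE.
pose v'u' : {linear P' i.+1 -> P' i.+1} := v' \o u'.
pose dh' : {linear P' i.+1 -> P' i.+1} := res_d P' i.+1 \o h'.
pose hd : {linear P' i.+1 -> P' i.+1} := h \o res_d P' i.
rewrite (tensor_map_comp (h := v'u')) // (tensor_map_comp (h := dh')) //.
pose dh'hd : {linear P' i.+1 -> P' i.+1} := dh' \+ hd.
rewrite (tensor_map_add (h := v'u') (f := (idfun : {linear _ -> _})) (g := dh'hd)); last first.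
  by move=> x; rewrite /= -hE addrC subrK.
rewrite (tensor_map_add (h := dh'hd) (f := dh') (g := hd)) // tensor_map_id //.
rewrite -(tensor_map_comp (h := hd) (f := res_d P' i) (g := h)) // dz raddf0 addr0.
by rewrite addrK.
Qed.

End TensorMap.

(** * Tor through a two-term projective resolution *)

Section TwoTermTor.
Variables (A : pzRingType) (M K P : rmodType A) (Y : lmodType A).
Variables (f : {linear K -> P}) (p : {linear P -> M}).
Hypotheses (Kproj : projective K) (Pproj : projective P) (fp : short_exact f p).

Lemma tensor_row0 (u : tensor ('rV[A^c]_0 : rmodType A) Y) : u = 0.
Proof.
by rewrite -[u](@tensor_map_id _ _ _ (idfun : {linear _ -> _})) // tensor_map0 // => x;
   exact: thinmx0.
Qed.

Lemma Tor0_injective : Tor0 1 M Y -> injective (@tensor_map A _ _ Y f).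
Proof.
move=> /(_ (two_term Kproj Pproj fp)) MY; apply: raddf_inj => u /MY[v <-].
exact: tensor_map0.
Qed.

Lemma injective_Tor0 i : injective (@tensor_map A _ _ Y f) -> (1 <= i)%N -> Tor0 i M Y.
Proof.
case: i => // i finj _ Q; apply: (@tensor_hom0_indep _ _ (two_term Kproj Pproj fp)).
case: i => [|i] u; split=> [fu|[v <-]].
- by exists 0; apply: finj; rewrite fu !raddf0.
- by rewrite [v]tensor_row0 !raddf0.
- by exists 0; rewrite [u]tensor_row0 raddf0.
- by rewrite [v]tensor_row0 !raddf0.
Qed.

End TwoTermTor.

(** * Presentations of modules of projective dimension one *)

Section Presentations.
Variable A : pzRingType.
Implicit Types M N P F X : lmodType A.

Lemma short_exact_ker N M (p : {linear N -> M}) :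
  surj p -> short_exact (@ker_val _ _ _ p) p.
Proof. by split=> //; [exact: val_inj|move=> x; exact: ker_valP]. Qed.

(** The half of Schanuel's lemma saying that [ker p] is an image, and a summand
    if [d] is injective, of [P1 * F]. *)
Lemma schanuel M F P0 P1 (p : {linear F -> M}) (e : {linear P0 -> M})
    (d : {linear P1 -> P0}) :
    projective F -> projective P0 -> surj p -> surj e -> exact_at d e ->
  exists r : {linear (P1 * F)%type -> kermod p},
    surj r /\ (injective d -> summand (kermod p) (P1 * F)%type).
Proof.
move=> Fproj P0proj psurj esurj de.
have [a aE] := Fproj _ _ e p esurj; have [b bE] := P0proj _ _ p e psurj.
have ed x : e (d x) = 0 by apply/de; exists x.
(* As p b a = e a = p, the element y - b a y lies in ker p, and so does each b d x. *)
pose r' : {linear (P1 * F)%type -> F} :=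
  copair (\0 \- (b \o d)) ((idfun : {linear F -> F}) \- (b \o a)).
have r'E x y : r' (x, y) = y - b (a y + d x).
  by rewrite /= sub0r [b (_ + _)]linearD opprD addrC addrA.
have [[x y]|r rE] := @lift_inj _ _ _ _ (@ker_val _ _ _ p) r' val_inj.
  by apply/ker_valP; rewrite r'E linearB bE linearD aE ed addr0 subrr.
have pk (k : kermod p) : p (ker_val k) = 0 by apply/ker_valP; exists k.
have split_r (k : kermod p) x : d x = - a (ker_val k) -> r (x, ker_val k) = k.
  by move=> dx; apply: val_inj; rewrite /= rE r'E dx subrr linear0 subr0.
have lift_k (k : kermod p) : exists x, d x = - a (ker_val k).
  by apply/de; rewrite linearN aE pk oppr0.
exists r; split=> [k|dinj].
  by have [x dx] := lift_k k; exists (x, ker_val k); exact: split_r.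
(* When [d] is injective, the solution x of d x = - a k depends linearly on k, so that k -> (x, k)
   is a section of [r]. *)
have [k|s sE] := @lift_inj _ _ _ _ d (\0 \- (a \o @ker_val _ _ _ p) : {linear _ -> _}) dinj.
  by have [x dx] := lift_k k; exists x; rewrite dx /= sub0r.
exists ((@pair_inl _ P1 F \o s) \+ (@pair_inr _ P1 F \o @ker_val _ _ _ p)
  : {linear _ -> _}), r.
move=> k; rewrite -[RHS](@split_r k (s k)); last by rewrite sE /= sub0r.
by congr (r _); rewrite -[RHS]pair_inlr.
Qed.

Lemma pd_le0_projective M : pd_le M 0 -> projective M.
Proof.
move=> [P P0]; apply: (@summand_projective _ _ _ _ (@res_proj _ _ P 0%N)).
have [||s sE] := @lift_inj _ _ _ _ (res_aug P) (idfun : {linear M -> M}).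
- apply: linear_inj => x /(@res_exact0 _ _ P)[y <-].
  by rewrite [y]P0 // linear0.
- exact: res_aug_surj.
- by exists s, (res_aug P).
Qed.

(** Two resolutions are compared with one finite free cover: the one of length 1 makes its kernel
    projective, the one by finitely generated modules makes it finitely generated. *)
Lemma P1_mod_presentation M : P1_mod M -> exists n (p : {linear 'rV[A]_n -> M}),
  [/\ surj p, projective (kermod p) & fin_generated (kermod p)].
Proof.
move=> [[P P2] [P' fgP']].
have [n [q qsurj]] := fg_rowP (fgP' 0%N).
exists n, (res_aug P' \o q : {linear _ -> _}).
set p : {linear _ -> _} := _ \o _.
have psurj : surj p.
  move=> x; have [y <-] := @res_aug_surj _ _ P' x; have [z <-] := qsurj y.
  by exists z.
split=> //.
  have [r [_ sum]] := schanuel (@row_projective _ n) (@res_proj _ _ P 0) psurj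
    (@res_aug_surj _ _ P) (@res_exact0 _ _ P).
  apply: summand_projective (sum _) _; last first.
    exact: projective_prod (@res_proj _ _ P 1) (@row_projective _ n).
  by apply: linear_inj => x /(@res_exactS _ _ P)[y <-]; rewrite [y]P2 // linear0.
have [r [rsurj _]] := schanuel (@row_projective _ n) (@res_proj _ _ P' 0) psurj
    (@res_aug_surj _ _ P') (@res_exact0 _ _ P').
exact: fg_surj rsurj (fg_prod (fgP' 1%N) (row_fg _ n)).
Qed.

Section Cokernel.
Variables (U V : lmodType A) (f : {linear U -> V}).

Definition img_pred : {pred V} := fun y => `[< exists x, f x = y >].

Lemma img_submod : submod_closed img_pred.
Proof.
split=> [|a _ _ /asboolP[x <-] /asboolP[y <-]]; apply/asboolP.
  by exists 0; rewrite linear0.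
by exists (a *: x + y); rewrite linearP.
Qed.
HB.instance Definition _ := GRing.isSubmodClosed.Build A V img_pred
  (GRing.submod_closed_semi img_submod).

Definition coker : lmodType A := mquot img_pred.

Definition coker_pi (x : V) : coker := \pi_(mquot img_pred) x.
HB.instance Definition _ := GRing.isLinear.Build A V coker *:%R coker_pi
  (mquot_pi_linear img_pred).

Lemma coker_piZ a x : coker_pi (a *: x) = a *: coker_pi x.
Proof. exact: linearZ. Qed.

Lemma coker_exact : exact_at f coker_pi.
Proof.
move=> y; rewrite -[0](linear0 coker_pi); split=> [/eqP|[x <-]].
  by rewrite mquotE subr0 => /asboolP.
by apply/eqP; rewrite mquotE subr0; apply/asboolP; exists x.
Qed.

Lemma coker_surj : surj coker_pi.
Proof. by move=> y; exists (repr y); rewrite /coker_pi reprK. Qed.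

Lemma short_exact_coker : injective f -> short_exact f coker_pi.
Proof. by split=> //; [exact: coker_exact|exact: coker_surj]. Qed.

End Cokernel.

Lemma fdim0_split (fdim0 : has_fdim A 0) (K P : lmodType A) (f : {linear K -> P}) :
    fin_generated K -> fin_generated P -> projective K -> projective P -> injective f ->
  exists g : {linear P -> K}, forall x, g (f x) = x.
Proof.
move=> Kfg Pfg Kproj Pproj finj; have se := short_exact_coker finj.
have cproj : projective (coker f).
  (* If the dimension of the cokernel were not 0 it would be exactly 1, above the bound given by
     f.dim. *)
  apply: pd_le0_projective; apply: contrapT => npd0.
  have : has_pd (coker f) 1.
    split=> [|[|m] //]; exact: (pd_le_two_term Kproj Pproj se).
  case: fdim0 => bound _.
  by move/(bound _ _ (fp_infty_two_term Kproj Pproj se Kfg Pfg)).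
have [s sE] := cproj _ _ (coker_pi f) (idfun : {linear _ -> _}) (coker_surj (f := f)).
have [x|g gE] := @lift_inj _ _ _ _ f
  ((idfun : {linear P -> P}) \- (s \o coker_pi f) : {linear _ -> _}) finj.
  by apply/coker_exact; rewrite linearB [X in _ - X]sE subrr.
exists g => x; apply: finj; rewrite gE /=.
have -> : coker_pi f (f x) = 0 by apply/coker_exact; exists x.
by rewrite linear0 subr0.
Qed.

End Presentations.

(** * Clearing denominators *)

Section Localization.

Lemma regular1 (R : pzRingType) : regular_elt (1 : R).
Proof. by split=> x y; rewrite ?mul1r ?mulr1. Qed.

Lemma regularM (R : pzRingType) (s t : R) :
  regular_elt s -> regular_elt t -> regular_elt (s * t).
Proof.
move=> [sl sr] [tl tr]; split=> x y.
  by rewrite -!mulrA => /sl/tl.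
by rewrite !mulrA => /tr/sr.
Qed.

Lemma regular_conv (R : pzRingType) (s : R) :
  regular_elt (s : R^c) <-> regular_elt s.
Proof. by split=> -[]. Qed.

(** Right [R]-modules are left [R^c]-modules, so the localization is needed over [R^c]; the two Ore
    conditions and the two kinds of fractions are exchanged. *)
Lemma quotients_conv (R Q : pzRingType) (iota : {rmorphism R -> Q}) :
    classical_ring_of_quotients iota ->
  exists iota_c : {rmorphism R^c -> Q^c}, classical_ring_of_quotients iota_c.
Proof.
move=> [[rO lO] inj inv lden rden].
pose i : R^c -> Q^c := iota.
have i_zmod : zmod_morphism i by move=> x y; exact: (rmorphB iota).
have i_mon : monoid_morphism i.
  by split=> [|x y]; [exact: (rmorph1 iota)|exact: (rmorphM iota)].
pose ic : {rmorphism R^c -> Q^c} := HB.pack i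
  (GRing.isZmodMorphism.Build R^c Q^c i i_zmod) (GRing.isMonoidMorphism.Build R^c Q^c i i_mon).
exists ic; split=> //.
- split=> a s /regular_conv ss.
    by have [b [t [/regular_conv ts E]]] := lO a s ss; exists b, t.
  by have [b [t [/regular_conv ts E]]] := rO a s ss; exists b, t.
- by move=> s /regular_conv/inv[y [ys sy]]; exists y.
- by move=> q; have [a [s [/regular_conv ss E]]] := rden q; exists a, s.
- by move=> q; have [a [s [/regular_conv ss E]]] := lden q; exists a, s.
Qed.

(** Induction on the family: the right Ore condition provides a common multiple s u = t c of the
    denominator [s] found so far and the denominator [t] of the next element. *)
Lemma common_right_denominator (R Q : pzRingType) (iota : {rmorphism R -> Q})
    (I : finType) (q : I -> Q) :
    classical_ring_of_quotients iota ->
  exists s (a : I -> R), regular_elt s /\ forall i, q i * iota s = iota (a i).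
Proof.
move=> [[rO _] _ _ _ rden].
suff [s [a [sreg sa]]] : exists s (a : I -> R),
    regular_elt s /\ forall i, i \in enum I -> q i * iota s = iota (a i).
  by exists s, a; split=> // i; apply: sa; rewrite mem_enum.
elim: (enum I) => [|i e [s [a [sreg sa]]]].
  by exists 1, (fun=> 0); split=> //; exact: regular1.
have [b [t [treg bt]]] := rden (q i).
have [c [u [ureg uc]]] := rO s t treg.
exists (s * u), (fun j => if j == i then b * c else a j * u).
split=> [|j]; first exact: regularM.
rewrite inE; have [-> _|_ /= je] := eqVneq j i.
  by rewrite uc !rmorphM mulrA bt.
by rewrite !rmorphM mulrA sa.
Qed.

Lemma common_left_denominator (R Q : pzRingType) (iota : {rmorphism R -> Q})
    (I : finType) (q : I -> Q) :
    classical_ring_of_quotients iota ->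
  exists s (a : I -> R), regular_elt s /\ forall i, iota s * q i = iota (a i).
Proof.
move=> [[_ lO] _ _ lden _].
suff [s [a [sreg sa]]] : exists s (a : I -> R),
    regular_elt s /\ forall i, i \in enum I -> iota s * q i = iota (a i).
  by exists s, a; split=> // i; apply: sa; rewrite mem_enum.
elim: (enum I) => [|i e [s [a [sreg sa]]]].
  by exists 1, (fun=> 0); split=> //; exact: regular1.
have [b [t [treg bt]]] := lden (q i).
have [c [u [ureg uc]]] := lO s t treg.
exists (u * s), (fun j => if j == i then c * b else u * a j).
split=> [|j]; first exact: regularM.
rewrite inE; have [-> _|_ /= je] := eqVneq j i.
  by rewrite uc !rmorphM -mulrA bt.
by rewrite !rmorphM -mulrA sa.
Qed.

Section MulmxLinear.
Variables (A : pzRingType) (m n : nat) (B : 'M[A]_(m, n)).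
Definition rmx (x : 'rV[A]_m) : 'rV[A]_n := x *m B.
Lemma rmx_linear : linear rmx.
Proof. by move=> a x y; rewrite /rmx mulmxDl scalemxAl. Qed.
HB.instance Definition _ := GRing.isLinear.Build A 'rV[A]_m 'rV[A]_n *:%R rmx rmx_linear.
End MulmxLinear.

Variables (A S : pzRingType) (j : {rmorphism A -> S}).
Hypotheses (Sloc : classical_ring_of_quotients j) (fdimS : has_fdim S 0).

(** An idempotent matrix encodes a finitely generated projective module, here the module of rows
    fixed by [E], so that base change is merely [map_mx]. The hypothesis on kernels makes [B]
    injective on this module, and [C] is the matrix of a retraction. *)
Lemma idempotent_split (m n : nat) (E : 'M[S]_m) (B : 'M[S]_(m, n)) :
    E *m E = E -> E *m B = B -> (forall x : 'rV_m, x *m B = 0 -> x *m E = 0) ->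
  exists C : 'M[S]_(n, m), B *m C = E.
Proof.
move=> EE EB kerB.
pose d : {linear 'rV[S]_m -> 'rV[S]_m} := (idfun : {linear _ -> _}) \- rmx E.
pose K := kermod d.
pose kv : {linear K -> 'rV[S]_m} := @ker_val _ _ _ _.
have KE (k : K) : kv k *m E = kv k.
  apply/esym/subr0_eq.
  by apply/(@ker_valP _ _ _ d); exists k.
have [x|e eE] := @lift_inj _ _ _ _ kv (rmx E) val_inj.
  apply/(@ker_valP _ _ _ d).
  by rewrite /= /rmx -mulmxA EE subrr.
have ke (k : K) : e (kv k) = k by apply: val_inj; rewrite [LHS]eE /= /rmx KE.
pose f : {linear K -> 'rV[S]_n} := rmx B \o kv.
have [|||||g gE] := fdim0_split fdimS (f := f).
- by apply: (@fg_surj _ _ _ e _ (row_fg S m)) => k; exists (kv k).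
- exact: row_fg.
- by apply: (summand_projective _ (@row_projective S m)); exists kv, e.
- exact: row_projective.
- by apply: linear_inj => k /kerB; rewrite KE => k0; apply: val_inj.
exists (lin1_mx (kv \o g)); apply/row_matrixP => i.
rewrite row_mul mul_rV_lin1 /= [row i B]rowE -EB mulmxA.
have -> : delta_mx 0 i *m E *m B = f (e (delta_mx 0 i)) by rewrite /= eE.
by rewrite gE eE rowE.
Qed.

Lemma idempotent_split_denominator (m n : nat) (E : 'M[A]_m) (B : 'M[A]_(m, n)) :
    E *m E = E -> E *m B = B -> (forall x : 'rV_m, x *m B = 0 -> x *m E = 0) ->
  exists (s : A) (C : 'M[A]_(n, m)),
    regular_elt s /\ B *m C = map_mx (fun x => x * s) E.
Proof.
move=> EE EB kerB; have [_ jinj jinv _ _] := Sloc.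
have mapj_inj k l : injective (map_mx j : 'M_(k, l) -> _).
  by move=> X Y /matrixP XY; apply/matrixP => x y; apply: jinj; have := XY x y; rewrite !mxE.
have [||x xB|C BC] := @idempotent_split m n (map_mx j E) (map_mx j B).
- by rewrite -map_mxM EE.
- by rewrite -map_mxM EB.
(* A row over [S] killed by [B] is a left multiple of a row over [A], and left scalars commute with
   the action of [B] and [E]. *)
- have [s [y [/jinv[t [ts _]] sy]]] := common_left_denominator (x 0) Sloc.
  have xE : x = t *: map_mx j (\row_i y i).
    by apply/rowP => i; rewrite !mxE -sy mulrA ts mul1r.
  have sxE : map_mx j (\row_i y i) = j s *: x.
    by apply/rowP => i; rewrite !mxE -sy.
  rewrite xE -scalemxAl -map_mxM kerB ?map_mx0 ?scaler0 //.
  apply: mapj_inj.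
  by rewrite map_mxM sxE -scalemxAl xB scaler0 map_mx0.
(* The denominator of [C] is taken on the right, where it passes through the product [B *m C]. *)
have [s [a [sreg sa]]] := common_right_denominator (fun p : 'I_n * 'I_m => C p.1 p.2) Sloc.
exists s, (\matrix_(i, k) a (i, k)); split=> //; apply: mapj_inj.
rewrite map_mxM; apply/matrixP => i k; rewrite !mxE rmorphM.
have -> : j (E i k) = (map_mx j B *m C) i k by rewrite BC mxE.
rewrite mxE mulr_suml; apply: eq_bigr => l _.
by rewrite !mxE -mulrA -(sa (l, k)).
Qed.

Lemma P1_mod_split (M : lmodType A) : P1_mod M ->
  exists (n m : nat) (K : lmodType A) (f : {linear K -> 'rV[A]_n})
    (p : {linear 'rV[A]_n -> M}) (e : {linear K -> 'rV[A]_m})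
    (q : {linear 'rV[A]_m -> K}) (s : A) (a : {linear 'rV[A]_n -> 'rV[A]_m}),
  [/\ projective K, short_exact f p, forall k, q (e k) = k, regular_elt s &
      forall k, a (f k) = map_mx (fun x => x * s) (e k)].
Proof.
move=> /P1_mod_presentation[n [p [psurj Kproj Kfg]]].
have [m [q qsurj]] := fg_rowP Kfg.
have [e e_id] := Kproj _ _ q (idfun : {linear _ -> _}) qsurj.
have eE k : q (e k) = k by exact: e_id.
pose f : {linear kermod p -> 'rV[A]_n} := @ker_val _ _ _ p.
(* [E] projects A^m onto the copy e(K) of K, and [B] is [q] followed by [f]. Since [f] is injective,
   rows killed by [B] are killed by [q], hence by [E]. *)
pose E := lin1_mx (e \o q : {linear _ -> _}); pose B := lin1_mx (f \o q : {linear _ -> _}).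
have xE x : x *m E = e (q x) by rewrite mul_rV_lin1.
have xB x : x *m B = f (q x) by rewrite mul_rV_lin1.
have [|||s [C [sreg BC]]] := @idempotent_split_denominator m n E B.
- by apply/row_matrixP => i; rewrite row_mul rowE !xE eE.
- by apply/row_matrixP => i; rewrite row_mul !rowE xE !xB eE.
- move=> x; rewrite xB xE => fq0; have -> : q x = 0 by apply: val_inj.
  exact: linear0.
exists n, m, (kermod p), f, p, e, q, s, (rmx C : {linear _ -> _}).
split=> //; first exact: short_exact_ker.
move=> k; rewrite /= /rmx -{1}[k]eE -xB -mulmxA BC.
apply/rowP => i; rewrite !mxE -[in RHS](eE k) /= -xE mxE mulr_suml.
by apply: eq_bigr => l _; rewrite !mxE mulrA.
Qed.

End Localization.

(** * Divisible and torsion free modules *)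

Section DivisibleModules.
Variable A : pzRingType.

(** Elementwise form of divisibility; [divisibleP] links it to the definition by Ext. *)
Definition divisible_module (D : lmodType A) : Prop :=
  forall r : A, regular_elt r -> forall d : D, exists d', r *: d' = d.

Lemma divisible_surj (M N : lmodType A) (f : {linear M -> N}) :
  surj f -> divisible_module M -> divisible_module N.
Proof.
move=> fsurj Mdiv r rreg y; have [x <-] := fsurj y.
by have [x' <-] := Mdiv r rreg x; exists (f x'); rewrite linearZ.
Qed.

Lemma divisible_prod (M N : lmodType A) :
  divisible_module M -> divisible_module N -> divisible_module (M * N)%type.
Proof.
move=> Mdiv Ndiv r rreg [x y].
have [x' <-] := Mdiv r rreg x; have [y' <-] := Ndiv r rreg y.
by exists (x', y').
Qed.

Lemma divisible_dsum (I : Type) (M : lmodType A) :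
  divisible_module M -> divisible_module (dsum I M).
Proof.
move=> Mdiv r rreg f.
(* Zero is divided by taking 0, so that the support stays finite. *)
have [i|g gE] := @choice I M (fun i d => r *: d = f i /\ (f i = 0 -> d = 0)).
  have [->|fi] := eqVneq (f i) 0; first by exists 0; rewrite scaler0.
  have [d dE] := Mdiv r rreg (f i); exists d; split=> // fi0.
  by rewrite fi0 eqxx in fi.
have gfin : g \in @finsupp A I M.
  case: f gE => f /= /asboolP ffin gE; apply/asboolP.
  apply: (sub_finite_set _ ffin) => i /=; apply: contra => /eqP fi.
  by apply/eqP; apply: (gE i).2.
by exists (Dsum gfin); apply: val_inj; apply: funext => i; exact: (gE i).1.
Qed.

End DivisibleModules.

Section RightScale.
Variables (A : pzRingType) (n : nat) (s : A).

(** Right multiplication by [s] respects the left module structure, which left multiplication need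
    not do; on basis vectors the two agree. *)
Definition rscale (x : 'rV[A]_n) : 'rV[A]_n := map_mx (fun a => a * s) x.

Lemma rscale_linear : linear rscale.
Proof. by move=> a x y; apply/rowP => i; rewrite !mxE mulrDl mulrA. Qed.
HB.instance Definition _ :=
  GRing.isLinear.Build A 'rV[A]_n 'rV[A]_n *:%R rscale rscale_linear.

Lemma rscale_inj : regular_elt s -> injective rscale.
Proof.
move=> [_ sr] x y /rowP xy; apply/rowP => i.
by have := xy i; rewrite !mxE; exact: sr.
Qed.

Lemma rscale_delta i : rscale (delta_mx 0 i) = s *: delta_mx 0 i.
Proof.
apply/rowP => k; rewrite !mxE.
by case: (_ && _); rewrite ?mul1r ?mulr1 ?mul0r ?mulr0.
Qed.

Lemma rscale_extends (D : lmodType A) (h : {linear 'rV[A]_n -> D}) :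
    (forall d : D, exists d', s *: d' = d) ->
  exists g : {linear 'rV[A]_n -> D}, forall x, h x = g (rscale x).
Proof.
move=> Ds; have [d dE] := choice (fun i => Ds (h (delta_mx 0 i))).
exists (rowlift d : {linear _ -> _}) => x; rewrite linear_rowlift.
by apply: eq_bigr => i _; rewrite mxE -scalerA dE.
Qed.

End RightScale.

(** * The modules R/rR, and elementwise divisibility and torsion freeness *)

Section Cyclic.
Variables (R : pzRingType).

(** Right multiplication by [r] in [R^c] is left multiplication in [R], so the image of [rscale] is
    rR, the kernel of this projection. *)
Definition cyclic_pi (r : R) (x : 'rV[R^c]_1) : cyclic_module r :=
  \pi_(@mquot R^c (R^c)^o (principal r)) (x 0 0).

Lemma cyclic_pi_linear r : linear (cyclic_pi r).
Proof. by move=> a x y; rewrite -mquot_pi_linear /cyclic_pi !mxE. Qed.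
HB.instance Definition _ r := GRing.isLinear.Build R^c 'rV[R^c]_1 (cyclic_module r)
  *:%R (cyclic_pi r) (cyclic_pi_linear r).

Lemma cyclic_short_exact (r : R) : regular_elt r ->
  short_exact (@rscale R^c 1 r) (cyclic_pi r).
Proof.
move=> rreg; split.
- by apply: rscale_inj; apply/(@regular_conv R r).
- move=> x; rewrite -[0](linear0 (cyclic_pi r)); split=> [/eqP|[y <-]].
    rewrite mquotE !mxE subr0 => /asboolP[s xs]; exists (\row__ (s : R^c)).
    by apply/rowP => i; rewrite !mxE ord1 -[RHS]/(x 0 0) xs.
  by apply/eqP; rewrite mquotE !mxE subr0; apply/asboolP; exists (y 0 0).
- move=> y; exists (\row__ (repr y : R^c)).
  by rewrite /= /cyclic_pi mxE reprK.
Qed.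

Lemma cyclic_P1_mod (r : R) : regular_elt r -> P1_mod (cyclic_module r).
Proof.
move=> /cyclic_short_exact se; split.
  exact: pd_le_two_term (@row_projective _ 1) (@row_projective _ 1) se.
exact: fp_infty_two_term (@row_projective _ 1) (@row_projective _ 1) se
  (row_fg _ 1) (row_fg _ 1).
Qed.

(** Extending the map 1 -> d along multiplication by r amounts to dividing d by r. *)
Lemma divisibleP (D : rmodType R) : divisible D <-> divisible_module D.
Proof.
split=> [Ddiv r /regular_conv rreg d|Ddiv r rreg]; last first.
  apply: (extends_Ext0 (@row_projective _ 1) (@row_projective _ 1)
    (cyclic_short_exact rreg)) => //.
  by move=> h; apply: rscale_extends; exact/Ddiv/regular_conv.
have [g gE] := Ext0_extends (@row_projective _ 1) (@row_projective _ 1)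
  (cyclic_short_exact rreg) (Ddiv r rreg) (rowlift (fun=> d)).
exists (g (delta_mx 0 0)).
by rewrite -linearZ -rscale_delta -gE /= rowlift_delta.
Qed.

Variable Y : lmodType R.

(** The coordinates of the isomorphism between R^n (x) Y and Y^n, under which [rscale] becomes the
    action of [r] on each coordinate. *)
Definition row_tensor_coord n (u : tensor ('rV[R^c]_n : rmodType R) Y) (i : 'I_n) : Y :=
  tensor_lift (fun (x : 'rV[R^c]_n) (y : Y) => (x 0 i : R) *: y) u.

Lemma row_coord_balanced n (i : 'I_n) :
  balanced (fun (x : ('rV[R^c]_n : rmodType R)) (y : Y) => (x 0 i : R) *: y).
Proof.
split=> [x x' y|x y y'|r x y].
- by rewrite mxE [LHS]scalerDl.
- by rewrite scalerDr.
- by rewrite scalerA mxE.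
Qed.

Lemma row_tensor_coord_pure n (x : 'rV[R^c]_n) (y : Y) i :
  row_tensor_coord (pure x y) i = (x 0 i : R) *: y.
Proof. exact: tensor_liftE (row_coord_balanced i) x y. Qed.

Lemma row_tensor_coordB n i :
  zmod_morphism (fun u : tensor ('rV[R^c]_n : rmodType R) Y => row_tensor_coord u i).
Proof. exact: tensor_liftB (row_coord_balanced i). Qed.

Lemma row_tensor_sum n (u : tensor ('rV[R^c]_n : rmodType R) Y) :
  u = \sum_i pure (delta_mx 0 i : 'rV[R^c]_n) (row_tensor_coord u i).
Proof.
have [Dl Dr bal] := pure_balanced ('rV[R^c]_n : rmodType R) Y.
have B x (y y' : Y) :
    pure x (y - y') = pure x y - pure x y' :> tensor ('rV[R^c]_n : rmodType R) Y.
  by apply/eqP; rewrite -(can2_eq (addrK _) (subrK _)) -Dr subrK.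
move: u; apply: (@tensor_ext _ _ _ _ idfun) => // [u v|x y].
  by rewrite -sumrB; apply: eq_bigr => i _; rewrite row_tensor_coordB B.
rewrite /= {1}[x]row_sum_delta.
pose px (x : 'rV[R^c]_n) : tensor ('rV[R^c]_n : rmodType R) Y := pure x y.
rewrite -[LHS]/(px _) (big_morph px (id1 := 0) (op1 := +%R)) //; last 2 first.
- by move=> x1 x2; rewrite /px Dl.
- exact: pure0l.
by apply: eq_bigr => i _; rewrite /px row_tensor_coord_pure -bal.
Qed.

Lemma row_tensor_coord_rscale n (r : R) (u : tensor ('rV[R^c]_n : rmodType R) Y) i :
  row_tensor_coord (tensor_map (@rscale R^c n r) u) i = r *: row_tensor_coord u i.
Proof.
move: u; apply: tensor_ext => [u v|u v|x y].
- by rewrite raddfB row_tensor_coordB.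
- by rewrite row_tensor_coordB scalerBr.
- by rewrite tensor_map_pure !row_tensor_coord_pure scalerA mxE.
Qed.

Lemma tensor_rscale_inj n (r : R) : (forall y : Y, r *: y = 0 -> y = 0) ->
  injective (@tensor_map R _ _ Y (@rscale R^c n r)).
Proof.
move=> ry; apply: raddf_inj => u u0; rewrite [u]row_tensor_sum big1 // => i _.
have coord0 : row_tensor_coord (0 : tensor ('rV[R^c]_n : rmodType R) Y) i = 0.
  by have := row_tensor_coordB i 0 0; rewrite !subrr.
have -> : row_tensor_coord u i = 0 by apply: ry; rewrite -row_tensor_coord_rscale u0.
exact: pure0r.
Qed.

(** If r y = 0, multiplication by r kills 1 (x) y; by injectivity this tensor is 0, and so is its
    coordinate y. *)
Lemma torsion_free_regular : torsion_free Y ->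
  forall r : R, regular_elt r -> forall y : Y, r *: y = 0 -> y = 0.
Proof.
move=> Ytf r rreg y ry.
have [_ _ bal] := pure_balanced ('rV[R^c]_1 : rmodType R) Y.
have rinj := Tor0_injective (@row_projective _ 1) (@row_projective _ 1)
  (cyclic_short_exact rreg) (Ytf r rreg).
have /(congr1 (fun u => row_tensor_coord u 0)) :
    pure (delta_mx 0 0 : 'rV[R^c]_1) y = 0 :> tensor ('rV[R^c]_1 : rmodType R) Y.
  by apply: rinj; rewrite raddf0 tensor_map_pure /= rscale_delta bal ry pure0r.
rewrite row_tensor_coord_pure mxE !eqxx scale1r => ->.
by have := row_tensor_coordB (n := 1) 0 0 0; rewrite !subrr.
Qed.

End Cyclic.

(** * Fuchs' tilting module *)

Section FreeModules.
Variable A : pzRingType.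
Implicit Types (I J : choiceType) (M : lmodType A).

Lemma dlift_single I M (h : I -> M) (x : dsum I A^o) i :
  (forall k, k != i -> x k = 0 \/ h k = 0) -> dlift h x = (x i : A) *: h i.
Proof.
move=> single.
have fin : finite_set ([set k | x k != 0] `|` [set i])%classic.
  by rewrite finite_setU; split; [exact: dsum_finite|exact: finite_set1].
rewrite (@dliftE _ _ _ h x _ fin); last by left.
rewrite fsbig_finite //= (bigD1_seq i) /=; last exact: finmap.fset_uniq.
  rewrite big1 ?addr0 // => k /single[->|->]; first by rewrite scale0r.
  by rewrite scaler0.
by rewrite in_fset_set // mem_set //; right.
Qed.

Definition dsum_eval I (i : I) (x : dsum I A^o) : A^o := x i.
Lemma dsum_eval_linear I (i : I) : linear (dsum_eval i).
Proof. by []. Qed.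
HB.instance Definition _ I (i : I) := GRing.isLinear.Build A (dsum I A^o) A^o *:%R
  (dsum_eval i) (dsum_eval_linear i).

Lemma dlift_eval I J (g : I -> dsum J A^o) x j :
  dlift g x j = dlift (fun i => g i j : A^o) x :> A.
Proof.
rewrite -[LHS]/((dsum_eval j \o dlift g) x).
rewrite (dsum_delta (dsum_eval j \o dlift g : {linear _ -> _})).
apply: (congr1 (fun h : I -> A^o => dlift h x)); apply: funext => i.
by rewrite /= dlift_delta.
Qed.

Lemma delta_same I (i : I) : @delta A I i i = 1.
Proof. by rewrite /= /delta_fun eqxx. Qed.

Lemma delta_neq I (i j : I) : j != i -> @delta A I i j = 0.
Proof. by rewrite /= /delta_fun => /negbTE ->. Qed.

Lemma dsum_linear_ext I M (f g : {linear dsum I A^o -> M}) :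
  (forall i, f (delta A i) = g (delta A i)) -> forall x, f x = g x.
Proof.
move=> fg x; rewrite (dsum_delta f) (dsum_delta g).
by congr (dlift _ x); exact: funext.
Qed.

Lemma summand_dsum (I : Type) (i : I) M : summand M (dsum I M).
Proof.
pose e (x : M) : I -> M := fun k => if `[< k = i >] then x else 0.
have e_fin x : e x \in @finsupp A I M.
  apply/asboolP; apply: (@sub_finite_set _ _ [set i]) => [k /=|]; last exact: finite_set1.
  by rewrite /e; case: asboolP => // _; rewrite eqxx.
have e_lin : linear (fun x => Dsum (e_fin x)).
  move=> a x y; apply: val_inj; apply: funext => k.
  rewrite -[RHS]/(a *: e x k + e y k) /= /e.
  by case: asboolP => // _; rewrite scaler0 addr0.
have ev_lin : linear (fun f : dsum I M => f i) by [].
pose s : {linear M -> dsum I M} := HB.pack (fun x => Dsum (e_fin x))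
  (GRing.isLinear.Build A M (dsum I M) *:%R (fun x => Dsum (e_fin x)) e_lin).
pose p : {linear dsum I M -> M} := HB.pack (fun f : dsum I M => f i)
  (GRing.isLinear.Build A (dsum I M) M *:%R (fun f : dsum I M => f i) ev_lin).
by exists s, p => x; rewrite /= /e; case: asboolP.
Qed.

End FreeModules.

Section FuchsModule.
Variable A : pzRingType.

Definition regularize (s : A) : A := if `[< regular_elt s >] then s else 1.

Lemma regularize_regular s : regular_elt (regularize s).
Proof. by rewrite /regularize; case: asboolP => // _; exact: regular1. Qed.

Lemma regularize_id s : regular_elt s -> regularize s = s.
Proof. by rewrite /regularize => /asboolP ->. Qed.

Let F : lmodType A := dsum (seq A) A^o.
Let F' : lmodType A := dsum (A * seq A)%type A^o.

(** Indexing by all sequences over [A], with [regularize] making every entry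
    act as a regular element, spares a subtype of regular elements. *)
Definition fuchs_rel (w : seq A) : F :=
  if w is s :: v then regularize s *: delta A w - delta A v else delta A [::].

(** The empty word contributes e_nil as a relation, so this map presents T_1; its restriction to
    nonempty words, [fuchs_map], presents T_0. *)
Definition fuchs_full : {linear F -> F} := dlift fuchs_rel.

Definition fuchs_incl : {linear F' -> F} := dlift (fun p => delta A (p.1 :: p.2)).

Definition fuchs_map : {linear F' -> F} := fuchs_full \o fuchs_incl.

Lemma fuchs_incl_cons x s v : fuchs_incl x (s :: v) = x (s, v) :> A.
Proof.
rewrite /fuchs_incl /= dlift_eval (@dlift_single _ _ _ _ _ (s, v)) => [|[t w] tw].
  by rewrite delta_same [LHS]mulr1.
by right; rewrite delta_neq // eqseq_cons -xpair_eqE eq_sym.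
Qed.

Lemma fuchs_incl_nil x : fuchs_incl x [::] = 0 :> A.
Proof.
rewrite /fuchs_incl /= dlift_eval (@dlift_single _ _ _ _ _ (0, [::])) => [|k _].
  by rewrite delta_neq // [LHS]mulr0.
by right; rewrite delta_neq.
Qed.

Lemma fuchs_incl_inj : injective fuchs_incl.
Proof.
apply: linear_inj => x x0; apply: val_inj; apply: funext => -[s v].
by rewrite -[LHS]fuchs_incl_cons x0.
Qed.

(** At a longest word [w] of the support of [x], the coefficient of [e_w] in
    the image is [x w] times a regular element. *)
Lemma fuchs_full_inj : injective fuchs_full.
Proof.
apply: linear_inj => x fx0.
have [N xN] : exists N, forall w, (N <= size w)%N -> x w = 0.
  pose X := fset_set [set w | x w != 0].
  exists (\max_(w <- finmap.enum_fset X) size w).+1 => w Nw.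
  apply: contrapT => /eqP xw; move: Nw; rewrite ltnNge => /negP; apply.
  apply: (@leq_bigmax_seq _ _ _ (fun w : seq A => size w)) => //.
  by rewrite in_fset_set ?inE //; exact: dsum_finite.
suff : forall w, (0 <= size w)%N -> x w = 0.
  by move=> x0; apply: val_inj; apply: funext => w; exact: x0.
elim: N xN => [//|N IH] xN; apply: IH => w.
rewrite leq_eqVlt => /orP[/eqP sw|]; last exact: xN.
have : fuchs_full x w = 0 :> A by rewrite fx0.
rewrite /fuchs_full /= dlift_eval (@dlift_single _ _ _ _ _ w) => [|[|s v] kw].
- case: w {sw} => [|s w]; first by rewrite delta_same [LHS in LHS = _]mulr1.
  rewrite [fuchs_rel _ _](_ : _ = regularize s); last first.
    rewrite -[LHS]/(regularize s * delta A (s :: w) (s :: w) - delta A w (s :: w)).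
    rewrite delta_same mulr1 delta_neq ?subr0 //.
    by apply/eqP => /(congr1 size) /= E; case: (n_Sn _ (esym E)).
  have [_ sr] := regularize_regular s.
  by move=> xs; apply: sr; rewrite mul0r.
- by right; rewrite delta_neq // eq_sym.
(* Besides its own relation, e_w occurs only in those of the longer words s :: w, where x already
   vanishes. *)
- have [wv|wv] := eqVneq w v; first by left; rewrite xN //= -wv -sw.
  right; rewrite -[LHS]/(regularize s * delta A (s :: v) w - delta A v w).
  by rewrite !delta_neq // ?mulr0 ?subr0 // eq_sym.
Qed.

Lemma fuchs_map_inj : injective fuchs_map.
Proof. exact: inj_comp fuchs_full_inj fuchs_incl_inj. Qed.

Definition fuchs0 : lmodType A := coker fuchs_map.

(** The embedding of A in the coresolution 0 -> A -> T_0 -> T_1 -> 0. *)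
Definition fuchs_root (a : A^o) : fuchs0 := (a : A) *: coker_pi fuchs_map (delta A [::]).
Lemma fuchs_root_linear : linear fuchs_root.
Proof. by move=> a x y; rewrite /fuchs_root scalerDl scalerA. Qed.
HB.instance Definition _ :=
  GRing.isLinear.Build A A^o fuchs0 *:%R fuchs_root fuchs_root_linear.

Lemma fuchs_rootE a : fuchs_root a = coker_pi fuchs_map ((a : A) *: delta A [::]).
Proof. exact: esym (coker_piZ _ _ _). Qed.

Definition fuchs1 : lmodType A := coker fuchs_root.

Definition fuchs1_pi : {linear F -> fuchs1} := coker_pi fuchs_root \o coker_pi fuchs_map.

Lemma fuchs_full_delta w : fuchs_full (delta A w) = fuchs_rel w.
Proof. exact: dlift_delta. Qed.

Lemma fuchs_map_delta s w :
  fuchs_map (delta A (s, w)) = regularize s *: delta A (s :: w) - delta A w.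
Proof. by rewrite /= dlift_delta /= dlift_delta. Qed.

Lemma fuchs_fullZ (a : A) : fuchs_full (a *: delta A [::]) = a *: delta A [::].
Proof. by rewrite linearZ fuchs_full_delta. Qed.

(** If a e_nil is a combination of the relations of T_0, injectivity of [fuchs_full] equates that
    combination with a e_nil in the source; but its coefficient at the empty word is 0. *)
Lemma fuchs_root_inj : injective fuchs_root.
Proof.
apply: linear_inj => a; rewrite [X in X = _]fuchs_rootE => /coker_exact[x] /=.
rewrite -[X in _ = X]fuchs_fullZ => /fuchs_full_inj.
move=> /(congr1 (dsum_eval [::]))/esym.
rewrite -[X in X = _]/((a : A) * delta A [::] [::]) delta_same mulr1 => ->.
exact: fuchs_incl_nil.
Qed.

Lemma fuchs0_short_exact : short_exact fuchs_map (coker_pi fuchs_map).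
Proof. exact: short_exact_coker fuchs_map_inj. Qed.

(** An element dying in T_1 differs from some a e_nil by a combination of the relations of T_0, and
    e_nil is itself a value of [fuchs_full]. *)
Lemma fuchs1_short_exact : short_exact fuchs_full fuchs1_pi.
Proof.
split; first exact: fuchs_full_inj; last first.
  move=> y; have [z <-] := @coker_surj _ _ _ fuchs_root y.
  by have [x <-] := @coker_surj _ _ _ fuchs_map z; exists x.
move=> x; split=> [/coker_exact[a]|[y <-]].
  rewrite [X in X = _]fuchs_rootE => ax.
  have /coker_exact[z zE] : coker_pi fuchs_map (x - (a : A) *: delta A [::]) = 0.
    by rewrite linearB -ax subrr.
  exists (fuchs_incl z + (a : A) *: delta A [::]).
  by rewrite linearD [X in X + _]zE fuchs_fullZ subrK.
have coker0 a : coker_pi fuchs_root (fuchs_root a) = 0 by apply/coker_exact; exists a.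
suff /(_ y) : forall y, (fuchs1_pi \o fuchs_full : {linear F -> fuchs1}) y =
    (\0 : {linear F -> fuchs1}) y by [].
apply: dsum_linear_ext => w.
rewrite [LHS](congr1 fuchs1_pi (fuchs_full_delta w)); case: w => [|s v].
  by rewrite -[RHS](coker0 1) /fuchs_root scale1r.
rewrite [LHS](congr1 fuchs1_pi (esym (fuchs_map_delta s v))).
have phi0 : coker_pi fuchs_map (fuchs_map (delta A (s, v))) = 0.
  by apply/coker_exact; exists (delta A (s, v)).
by rewrite [LHS](congr1 (coker_pi fuchs_root) phi0) linear0.
Qed.

(** Ore: write [a t = s b] with [t] regular; then
    [a e_w = a t e_(t::w) = s (b e_(t::w))]. *)
Lemma fuchs0_divisible : right_Ore A -> divisible_module fuchs0.
Proof.
move=> right_ore s sreg y; have [x <-] := @coker_surj _ _ _ fuchs_map y.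
rewrite (dsum_delta (coker_pi fuchs_map : {linear F -> fuchs0})) /dlift.
rewrite fsbig_finite /=; last exact: dsum_finite.
apply: (big_ind (fun y : fuchs0 => exists y', s *: y' = y)).
- by exists 0; rewrite scaler0.
- by move=> _ _ [y1 <-] [y2 <-]; exists (y1 + y2); rewrite scalerDr.
move=> w _; have [b [t [treg tb]]] := right_ore (x w) s sreg.
exists (b *: coker_pi fuchs_map (delta A (t :: w))).
rewrite scalerA -tb -scalerA; congr (_ *: _); apply/subr0_eq.
have phi0 : coker_pi fuchs_map (fuchs_map (delta A (t, w))) = 0.
  by apply/coker_exact; exists (delta A (t, w)).
by rewrite -[RHS]phi0 fuchs_map_delta (regularize_id treg) linearB linearZ.
Qed.

Lemma fuchs1_divisible : right_Ore A -> divisible_module fuchs1.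
Proof. by move/fuchs0_divisible; exact: divisible_surj (@coker_surj _ _ _ fuchs_root). Qed.

Section Extension.
Variable D : lmodType A.
Hypothesis Ddiv : divisible_module D.

(** The equation at s :: v involves only the earlier value c v, so division in [D] solves the system
    recursively. *)
Lemma fuchs_solve (t : seq A -> D) : exists c : seq A -> D,
  c [::] = t [::] /\ forall s v, regularize s *: c (s :: v) = t (s :: v) + c v.
Proof.
have [[s d]|dv dvE] := @choice (A * D) D (fun p d' => regularize p.1 *: d' = p.2).
  exact/Ddiv/regularize_regular.
exists (fix c w := if w is s :: v then dv (s, t w + c v) else t [::]).
by split=> // s v; exact: (dvE (s, _)).
Qed.

Lemma fuchs_full_extends : extends fuchs_full D.
Proof.
move=> h; have [c [c0 cS]] := fuchs_solve (fun w => h (delta A w)).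
exists (dlift c : {linear F -> D}) => x.
pose g : {linear F -> D} := (dlift c : {linear F -> D}) \o fuchs_full.
suff /(_ x) : forall x, h x = g x by [].
apply: dsum_linear_ext => w.
rewrite [RHS](congr1 (dlift c) (fuchs_full_delta w)); case: w => [|s v] /=.
  by rewrite dlift_delta c0.
by rewrite linearB linearZ /= !dlift_delta cS addrK.
Qed.

Lemma fuchs_map_extends : extends fuchs_map D.
Proof.
(* T_0 has no relation at the empty word, so the value there is free; 0 is taken. *)
move=> h; pose t w := if w is s :: v then h (delta A (s, v)) else 0.
have [c [c0 cS]] := fuchs_solve t.
exists (dlift c : {linear F -> D}) => x.
pose g : {linear F' -> D} := (dlift c : {linear F -> D}) \o fuchs_map.
suff /(_ x) : forall x, h x = g x by [].
apply: dsum_linear_ext => -[s v].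
rewrite [RHS](congr1 (dlift c) (fuchs_map_delta s v)).
by rewrite linearB linearZ /= !dlift_delta cS addrK.
Qed.

End Extension.

(** Extend the map with value d at the empty word and 0 elsewhere: the relations give g e_nil = d
    and s g e_[s] = g e_nil. *)
Lemma fuchs_full_extends_divisible (D : lmodType A) :
  extends fuchs_full D -> divisible_module D.
Proof.
move=> Dext s sreg d.
have [g gE] := Dext (dlift (fun w => if w is [::] then d else 0) : {linear F -> D}).
have gw w : g (fuchs_rel w) = if w is [::] then d else 0.
  by rewrite -fuchs_full_delta -gE /= dlift_delta.
exists (g (delta A [:: s])).
rewrite -[RHS](gw [::]); apply: subr0_eq.
by rewrite -[RHS](gw [:: s]) linearB linearZ (regularize_id sreg).
Qed.

Definition fuchs_tilting : lmodType A := (fuchs0 * fuchs1)%type.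

Definition fuchs_tilting_map : {linear (F' * F)%type -> (F * F)%type} :=
  prodmap fuchs_map fuchs_full.

Lemma fuchs_tilting_short_exact :
  short_exact fuchs_tilting_map (prodmap (coker_pi fuchs_map) fuchs1_pi).
Proof. exact: short_exact_prod fuchs0_short_exact fuchs1_short_exact. Qed.

Let F'F_proj : projective (F' * F)%type.
Proof. exact: projective_prod (@free_projective _ _) (@free_projective _ _). Qed.

Let FF_proj : projective (F * F)%type.
Proof. exact: projective_prod (@free_projective _ _) (@free_projective _ _). Qed.

Lemma fuchs_tilting_perp X : divisible_module X <-> Ext_perp (eq fuchs_tilting) X.
Proof.
have se := fuchs_tilting_short_exact; split=> [Xdiv _ <- i|].
  apply: (extends_Ext0 F'F_proj FF_proj se).
  exact: extends_prod (fuchs_map_extends Xdiv) (fuchs_full_extends Xdiv).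
move=> /(_ _ erefl 1%N erefl)/(Ext0_extends F'F_proj FF_proj se)/extends_prodr.
exact: fuchs_full_extends_divisible.
Qed.

(** By the Ore condition the module is divisible, hence so are its direct sums, which therefore lie
    in its own Ext orthogonal. *)
Lemma fuchs_one_tilting : right_Ore A -> one_tilting fuchs_tilting.
Proof.
move=> rO; have T_Add : summand fuchs_tilting (dsum unit fuchs_tilting).
  exact: (summand_dsum tt fuchs_tilting).
split.
- exact: pd_le_two_term F'F_proj FF_proj fuchs_tilting_short_exact.
- move=> I; have /fuchs_tilting_perp : divisible_module (dsum I fuchs_tilting).
    apply/divisible_dsum/divisible_prod; first exact: fuchs0_divisible.
    exact: fuchs1_divisible.
  by move=> /(_ _ erefl 1%N erefl).
- exists fuchs0, fuchs1, fuchs_root, (coker_pi fuchs_root); split.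
  + by exists unit; apply: summand_trans T_Add; exact: summand_prodl.
  + by exists unit; apply: summand_trans T_Add; exact: summand_prodr.
  + exact: fuchs_root_inj.
  + exact: coker_exact.
  + exact: coker_surj.
Qed.

End FuchsModule.

(** * The Ext and Tor orthogonals of P_1(mod-R) *)

Section FiniteType.
Variables (R Q : pzRingType) (iota : {rmorphism R -> Q}).
Hypotheses (Q_quot : classical_ring_of_quotients iota) (fdimQ : has_fdim Q^c 0).

Lemma divisible_Ext_perp (D : rmodType R) : divisible D <-> Ext_perp (@P1_mod R^c) D.
Proof.
split=> [/divisibleP Ddiv C CP1 i|DP1 r rreg]; last exact: DP1 (cyclic_P1_mod rreg) _ _.
have [iota_c Qc_quot] := quotients_conv Q_quot.
have [n [m [K [f [p [e [q [s [a [Kproj se qe sreg af]]]]]]]]]] :=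
  P1_mod_split Qc_quot fdimQ CP1.
apply: (extends_Ext0 Kproj (@row_projective _ n) se) => h.
(* Dividing h q by [s] gives [g], and then g a f k = g (e k s) = h (q (e k)) = h k. *)
have [g gE] := @rscale_extends _ _ s D (h \o q : {linear _ -> _}) (Ddiv s sreg).
exists (g \o a : {linear _ -> _}) => k.
by rewrite -[in LHS](qe k) [LHS](gE (e k)) /= af.
Qed.

Lemma torsion_free_Tor_perp (Y : lmodType R) :
  torsion_free Y <-> Tor_perp (@P1_mod R^c) Y.
Proof.
split=> [Ytf C CP1 i|YP1 r rreg]; last exact: YP1 (cyclic_P1_mod rreg) _ _.
have [iota_c Qc_quot] := quotients_conv Q_quot.
have [n [m [K [f [p [e [q [s [a [Kproj se qe sreg af]]]]]]]]]] :=
  P1_mod_split Qc_quot fdimQ CP1.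
apply: (injective_Tor0 Kproj (@row_projective _ n) se).
apply: raddf_inj => u fu.
have rinj := tensor_rscale_inj (n := m)
  (torsion_free_regular Ytf ((@regular_conv R s).1 sreg)).
pose se' : {linear K -> 'rV[R^c]_m} := @rscale R^c m s \o e.
(* Since a f is [e] followed by multiplication by [s], which stays injective after tensoring with
   [Y], the vanishing of f u forces that of e u; [e] is split by [q]. *)
have eu : tensor_map e u = 0.
  apply: rinj; rewrite raddf0 (tensor_map_comp (h := se')) //.
  by rewrite -(tensor_map_comp (f := f) (g := a)) // fu raddf0.
pose qe' : {linear K -> K} := q \o e.
rewrite -[LHS](tensor_map_id (f := qe')) //.
by rewrite -(tensor_map_comp (f := e) (g := q)) // eu raddf0.
Qed.

End FiniteType.

Theorem proposition6p3 (R Q : pzRingType) (iota : {rmorphism R -> Q})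
    (Q_quot : classical_ring_of_quotients iota)
    (fdimQ : has_fdim Q^c 0) :
  (one_tilting_class (@divisible R) /\
   forall D : rmodType R, divisible D <-> Ext_perp (@P1_mod R^c) D) /\
  (forall Y : lmodType R, torsion_free Y <-> Tor_perp (@P1_mod R^c) Y).
Proof.
split; last exact: torsion_free_Tor_perp Q_quot fdimQ.
split; last exact: divisible_Ext_perp Q_quot fdimQ.
(* The right Ore condition for [R^c], used to divide in the tilting module, is the left one for
   [R]. *)
have [iota_c [[rO _] _ _ _ _]] := quotients_conv Q_quot.
exists (fuchs_tilting R^c); split; first exact: fuchs_one_tilting.
by move=> X; rewrite divisibleP; exact: fuchs_tilting_perp.
Qed.
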